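(* Let $d\ge 1$, let $p(\cdot)$ be a probability measure on $\mathbb{Z}^d$ and let $\alpha\in(c,1]^{\mathbb{Z}^d}$ be a given environment. For $x\in\mathbb{Z}^d$ let $(\check X^x_n)_{n\in\mathbb{N}}$ be the random walk on $\mathbb{Z}^d$ started from $x$ with jump kernel $\check p(z)=p(-z)$. Assume that for every $x\in\mathbb{Z}^d$, $\liminf_{n\to+\infty}\alpha(\check X^x_n)=c$ almost surely. Then for every $\eta_0\in\mathbb{N}^{\mathbb{Z}^d}$ and every bounded local nondecreasing function $h:\mathbf{X}\to\mathbb{R}$, the zero-range process $(\eta^\alpha_t)_{t\ge0}$ in environment $\alpha$ with initial configuration $\eta_0$ satisfies $$\limsup_{t\to\infty}\mathbb{E}\,h(\eta^\alpha_t)\le\int_{\mathbf{X}}h(\eta)\,d\mu^\alpha_c(\eta).$$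
   Context: $\mathbb{N}=\{0,1,\dots\}$, $\overline{\mathbb{N}}=\mathbb{N}\cup\{+\infty\}$. Fix $c\in(0,1)$. An environment is an element $\alpha=(\alpha(x))_{x\in\mathbb{Z}^d}$ of $(c,1]^{\mathbb{Z}^d}$. Let $g:\mathbb{N}\to[0,+\infty)$ be nondecreasing with $g(0)=0<g(1)\le\lim_{n\to\infty}g(n)=1$, extended by $g(+\infty)=1$. $\mathbf{X}=\overline{\mathbb{N}}^{\mathbb{Z}^d}$ has the product topology (it is compact metrizable) and the coordinatewise partial order. A function on $\mathbf{X}$ is local if it depends on finitely many coordinates. $(\eta^\alpha_t)_{t\ge0}$ is the Feller process on $\mathbf{X}$ with generator given on continuous local functions by $$L^\alpha f(\eta)=\sum_{x,y\in\mathbb{Z}^d}\alpha(x)p(y-x)g(\eta(x))[f(\eta^{x,y})-f(\eta)],$$ where $\eta^{x,y}=\eta-\delta_x+\delta_y$ (one particle moved from $x$ to $y$), with the convention that infinite occupation numbers remain infinite; $\mathbb{E}$ is expectation for this process. For $\lambda\in[0,1)$, $\theta_\lambda$ is the probability measure on $\mathbb{N}$ with $\theta_\lambda(n)=Z(\lambda)^{-1}\lambda^n/g(n)!$, where $g(n)!=\prod_{k=1}^n g(k)$, $g(0)!=1$, and $Z(\lambda)=\sum_{n\ge0}\lambda^n/g(n)!$. For $\lambda\in[0,c]$, $\mu^\alpha_\lambda$ is the product measure on $\mathbf{X}$ whose marginal at $x$ is $\theta_{\lambda/\alpha(x)}$. *)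

(* Defs.v *)
From HB Require Import structures.
From mathcomp Require Import all_boot all_order all_algebra.
From mathcomp Require Import all_classical all_reals all_analysis.

Set Implicit Arguments.
Unset Strict Implicit.
Unset Printing Implicit Defensive.

Import Order.TTheory GRing.Theory Num.Theory.
Import numFieldNormedType.Exports.

Local Open Scope classical_set_scope.
Local Open Scope ring_scope.

(* Z^d *)
Notation site d := 'rV[int]_d.

(* N u {+oo}: [Some n] is the integer n and [None] is +oo; [nat] is discrete *)
Notation natbar := (one_point_compactification nat).

Definition le_natbar (a b : natbar) : Prop :=
  match a, b with
  | _, None => True
  | Some m, Some n => (m <= n)%N
  | None, Some _ => False
  end.

(* The configuration space, with the product topology and its Borel
   sigma-algebra. *)
Definition config (d : nat) : Type := prod_topology (fun _ : site d => natbar).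
HB.instance Definition _ d := Topological.on (config d).
HB.instance Definition _ d := Pointed.copy (config d) (site d -> natbar).
HB.instance Definition _ d := @isMeasurable.Build
  (sigma_display (@open (config d))) (config d) <<s @open (config d) >>
  (@sigma_algebra0 _ setT (@open (config d)))
  (@sigma_algebraC (config d) (@open (config d)))
  (@sigma_algebra_bigcup _ setT (@open (config d))).

Section functions_on_configurations.
Context {R : realType} {d : nat}.
Implicit Types f : config d -> R.

Definition local_fun f := exists s : seq (site d), forall eta zeta : config d,
  (forall x : site d, x \in s -> eta x = zeta x) -> f eta = f zeta.

Definition nondecreasing_config f := forall eta zeta : config d,
  (forall x, le_natbar (eta x) (zeta x)) -> f eta <= f zeta.

End functions_on_configurations.

Section parameters.
Context {R : realType} {d : nat}.

Definition environment (c : R) (alpha : site d -> R) :=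
  forall x, c < alpha x <= 1.

Definition jump_rate (g : nat -> R) :=
  [/\ forall n, 0 <= g n, {homo g : m n / (m <= n)%N >-> m <= n},
      g 0%N = 0, 0 < g 1%N & g @ \oo --> (1 : R)].

Definition extend_rate (g : nat -> R) (n : natbar) : R :=
  if n is Some m then g m else 1.

Definition jump_law (p : site d -> R) :=
  (forall z, 0 <= p z) /\ (\esum_(z in [set: site d]) (p z)%:E = 1)%E.

End parameters.

(* Sum of an absolutely summable family of reals. *)
Definition real_sum {R : realType} {I : choiceType} (F : I -> R) : R :=
  fine (\esum_(i in [set: I]) (F^\+ i)%:E) -
  fine (\esum_(i in [set: I]) (F^\- i)%:E).

(* eta - delta_x + delta_y; infinite occupation numbers are unchanged.
   When eta x = 0 the truncated subtraction is harmless, the jump having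
   rate g 0 = 0. *)
Definition move {d} (x y : site d) (eta : config d) : config d :=
  fun z => omap (fun n => (n - (z == x) + (z == y))%N) (eta z).

Definition zr_generator {R : realType} {d} (g : nat -> R) (p alpha : site d -> R)
    (f : config d -> R) (eta : config d) : R :=
  real_sum (fun xy : site d * site d =>
    alpha xy.1 * p (xy.2 - xy.1) * extend_rate g (eta xy.1) *
    (f (move xy.1 xy.2 eta) - f eta)).

Section feller_processes.
Context {R : realType} {d : nat}.
Variable S : R -> R.-pker (config d) ~> (config d).

Definition transition_op (t : R) (f : config d -> R) (eta : config d) : R :=
  \int[S t eta]_zeta f zeta.

(* Only the kernels S t with 0 <= t are meaningful. *)
Definition feller_semigroup :=
  [/\ forall eta (A : set (config d)), measurable A -> S 0 eta A = \d_eta A,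
      forall (s t : R) eta (A : set (config d)), 0 <= s -> 0 <= t -> measurable A ->
        (S (s + t) eta A = \int[S s eta]_zeta S t zeta A)%E,
      forall (t : R) (f : config d -> R), 0 <= t ->
        continuous f -> continuous (transition_op t f) &
      forall f : config d -> R, continuous f ->
        {uniform, (transition_op ^~ f) @ 0^'+ --> f}].

(* f is in the domain of the generator, which maps it to Lf. *)
Definition in_generator (f Lf : config d -> R) :=
  continuous f /\
  {uniform, (fun t eta => t^-1 * (transition_op t f eta - f eta)) @ 0^'+
    --> Lf}.

Context {dO} {Omega : measurableType dO} {P : probability Omega R}.
Variable eta : R -> {RV P >-> config d}.

Definition natural_filtration (s : R) : set (set Omega) :=
  <<s [set A | exists u : R, 0 <= u <= s /\
        exists2 B : set (config d), measurable B & A = eta u @^-1` B] >>.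

Definition markov_process :=
  forall (s t : R) (A : set Omega) (B : set (config d)), 0 <= s -> s <= t ->
    natural_filtration s A -> measurable B ->
    (P (A `&` eta t @^-1` B) = \int[P]_(w in A) S (t - s) (eta s w) B)%E.

End feller_processes.

Definition zero_range_process {R : realType} {d} (g : nat -> R)
    (p alpha : site d -> R) {dO} {Omega : measurableType dO}
    {P : probability Omega R} (eta : R -> {RV P >-> config d})
    (eta0 : config d) :=
  exists S : R -> R.-pker (config d) ~> (config d),
  [/\ feller_semigroup S,
      forall f : config d -> R, continuous f -> local_fun f ->
        in_generator S f (zr_generator g p alpha f),
      markov_process S eta &
      {ae P, forall w : Omega, eta 0 w = eta0}].

Definition random_walk {R : realType} {d} (q : site d -> R) (x : site d)
    {dW} {W : measurableType dW} (P : probability W R)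
    (X : nat -> W -> site d) :=
  (forall n y, measurable [set w | X n w = y]) /\
  forall n (y : nat -> site d),
    P [set w | forall i, (i <= n)%N -> X i w = y i] =
    ((y 0%N == x)%:R * \prod_(i < n) q (y i.+1 - y i))%:E.

Section invariant_measures.
Context {R : realType}.
Variable g : nat -> R.

Definition gfact (n : nat) : R := \prod_(1 <= k < n.+1) g k.

Definition partition_fun (lambda : R) : R :=
  limn (series (fun n => lambda ^+ n / gfact n)).

Definition theta (lambda : R) (n : nat) : R :=
  (partition_fun lambda)^-1 * (lambda ^+ n / gfact n).

(* theta as a measure on N u {+oo}, not charging +oo. *)
Definition theta_measure (lambda : R) (A : set natbar) : \bar R :=
  (\esum_(n in [set n : nat | A (Some n)]) (theta lambda n)%:E)%E.

(* All subsets of natbar are Borel, so A x is unrestricted. *)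
Definition product_measure_of {d} (m : site d -> set natbar -> \bar R)
    (mu : probability (config d) R) :=
  forall (s : seq (site d)) (A : site d -> set natbar), uniq s ->
    mu [set eta : config d | forall x : site d, x \in s -> A x (eta x)] =
    (\prod_(x <- s) m x (A x))%E.

Definition is_mu {d} (alpha : site d -> R) (lambda : R) :=
  product_measure_of (fun x : site d => theta_measure (lambda / alpha x)).

End invariant_measures.

(* Main.v *)
Require Import Defs.
From HB Require Import structures.
From mathcomp Require Import all_boot all_order all_algebra.
From mathcomp Require Import all_classical all_reals all_analysis.
From mathcomp Require Import measurable_realfun.
From mathcomp Require Import ring lra zify.

(** Proof idea.  Fix a finite set of sites and declare all the other sites to be
   sources, i.e. to carry infinitely many particles.  The resulting finite
   network is attractive and dominates the zero-range process: for a
   nondecreasing function [F] of the finitely many occupation numbers,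
   the generator [L] of the process satisfies [L F <= K (T F - F)], where [T] is
   the transition kernel of the uniformized network.  Integrating this inequality
   along the semigroup gives [limsup_t E F(eta_t) <= limsup_n T^n F(eta_0)].

   If [lambda] is superharmonic for the reversed walk on the finite set, lies
   below [alpha] there and equals [alpha] on the sources, then the product of the
   measures [theta_(lambda/alpha)] is superstationary for nondecreasing functions;
   the decrease of the [L^2] norm of [T^n F] then forces the gradients of [T^n F]
   to vanish, so that [limsup_n T^n F(eta_0)] is at most the mean of [F].

   Such a [lambda] is produced by the iteration [lambda |-> min (alpha, mean of
   lambda over one step of the reversed walk)] on a large finite box, started from
   [alpha].  As the reversed walk almost surely visits sites where [alpha] is close
   to [c], [lambda] is close to [c] on any given finite set of sites.  *)

Set Implicit Arguments.
Unset Strict Implicit.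
Unset Printing Implicit Defensive.

Import Order.TTheory GRing.Theory Num.Theory.
Import numFieldNormedType.Exports.

Local Open Scope classical_set_scope.
Local Open Scope ring_scope.

(** * Weighted sums *)

(** The network enters only through its one-step kernel [T]: the quantities a_n(t) = E (T^n
    F)(eta_t), which satisfy a_n' <= K (a_(n+1) - a_n), replace a coupling of two processes. For
    this every T^n F has to be a continuous local function, the generator being given on those
    alone; hence [h] is replaced by functions of finitely many occupation levels, obtained by
    rounding up.

    The product measure is superstationary rather than invariant, and only against nondecreasing
    functions. Attractiveness keeps T^n F nondecreasing, and nonnegativity keeps its square
    nondecreasing, which is what the L^2 argument uses; this is one reason for working with
    nonnegative functions.

    The measure theta_(lambda/alpha) is normalizable only when lambda < alpha. The sites where the
    profile lambda equals alpha are therefore exactly those turned into sources. Since alpha > c, a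
    profile close enough to c leaves the finitely many coordinates seen by [h] inside the
    network. *)

Section nonneg_bounded.
Context {R : realType} {T : Type}.
Implicit Types F G : T -> R.

Definition nonneg_bounded F := exists M, forall x, 0 <= F x <= M.

Lemma nonneg_bounded_ge0 F x : nonneg_bounded F -> 0 <= F x.
Proof. by move=> [M /(_ x)/andP[]]. Qed.

Lemma nonneg_boundedD F G : nonneg_bounded F -> nonneg_bounded G ->
  nonneg_bounded (fun x => F x + G x).
Proof.
move=> [M FM] [N GN]; exists (M + N) => x.
have /andP[? ?] := FM x; have /andP[? ?] := GN x.
by rewrite addr_ge0// lerD.
Qed.

Lemma nonneg_boundedZ F (k : R) : 0 <= k -> nonneg_bounded F ->
  nonneg_bounded (fun x => k * F x).
Proof.
move=> k0 [M FM]; exists (k * M) => x; have /andP[? ?] := FM x.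
by rewrite mulr_ge0// ler_wpM2l.
Qed.

Lemma nonneg_boundedM F G : nonneg_bounded F -> nonneg_bounded G ->
  nonneg_bounded (fun x => F x * G x).
Proof.
move=> [M FM] [N GN]; exists (M * N) => x.
have /andP[? ?] := FM x; have /andP[? ?] := GN x.
by rewrite mulr_ge0// ler_pM.
Qed.

Lemma nonneg_bounded_sum (I : Type) (r : seq I) (F : I -> T -> R) :
  (forall i, nonneg_bounded (F i)) ->
  nonneg_bounded (fun x => \sum_(i <- r) F i x).
Proof.
move=> bF; elim: r => [|i r IH].
  by exists 0 => x; rewrite big_nil lexx.
have -> : (fun x => \sum_(j <- i :: r) F j x) =
          (fun x => F i x + \sum_(j <- r) F j x).
  by apply/funext => x; rewrite big_cons.
exact: nonneg_boundedD.
Qed.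

End nonneg_bounded.

Lemma nonneg_bounded_comp (R : realType) (S T : Type) (F : T -> R) (f : S -> T) :
  nonneg_bounded F -> nonneg_bounded (F \o f).
Proof. by move=> [M FM]; exists M => x; exact: FM. Qed.

Section weighted_sums.
Context {R : realType} {T : choiceType}.
Implicit Types (A D : set T) (a w F G : T -> R).

(** Scaling finite partial sums gives one inequality; applied to the inverse factor it gives the
    other, [k = 0] being treated apart. *)
Lemma esumZl D a (k : R) : 0 <= k -> (forall x, 0 <= a x) ->
  (\esum_(x in D) (k * a x)%:E = k%:E * \esum_(x in D) (a x)%:E)%E.
Proof.
move=> k0 a0.
have le_esumZl (l : R) (b : T -> R) : 0 <= l -> (forall x, 0 <= b x) ->
    (\esum_(x in D) (l * b x)%:E <= l%:E * \esum_(x in D) (b x)%:E)%E.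
  move=> l0 b0; apply: ge_ereal_sup => _ [X [finX XD] <-].
  under eq_fsbigr do rewrite EFinM.
  rewrite -ge0_mule_fsumr; last by move=> x; rewrite lee_fin.
  by apply: lee_wpmul2l; [rewrite lee_fin|apply: ereal_sup_ubound; exists X].
apply/eqP; rewrite eq_le le_esumZl//=.
move: k0; rewrite [0 <= k]le_eqVlt => /predU1P[<-|k0].
  by rewrite mul0e esum_ge0// => x _; rewrite lee_fin mul0r.
have : (\esum_(x in D) (a x)%:E <= k^-1%:E * \esum_(x in D) (k * a x)%:E)%E.
  have /le_esumZl : 0 <= k^-1 by rewrite invr_ge0 ltW.
  move=> /(_ (fun x => k * a x) (fun x => mulr_ge0 (ltW k0) (a0 x))).
  by under eq_esum do rewrite mulrA mulVf ?gt_eqF// mul1r.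
have k0' : (0 <= k%:E)%E by rewrite lee_fin ltW.
move=> /(lee_wpmul2l k0').
by rewrite muleA -EFinM mulfV ?gt_eqF// mul1e.
Qed.

Definition weighted_sum w F : R := fine (\esum_(x in [set: T]) (w x * F x)%:E).

Variable w : T -> R.
Hypothesis w0 : forall x, 0 <= w x.
Hypothesis wfin : (\esum_(x in [set: T]) (w x)%:E < +oo)%E.

Lemma esum_weighted_fin D F : nonneg_bounded F ->
  \esum_(x in D) (w x * F x)%:E \is a fin_num.
Proof.
move=> bF; have [M FM] := bF.
rewrite ge0_fin_numE; last first.
  by apply: esum_ge0 => x _; rewrite lee_fin mulr_ge0// nonneg_bounded_ge0.
apply: (@le_lt_trans _ _ (`|M|%:E * \esum_(x in [set: T]) (w x)%:E)%E).
  rewrite -esumZl// esum_mkcond; apply: le_esum => x _.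
  have /andP[Fx0 FxM] := FM x.
  case: ifPn => _; rewrite lee_fin ?mulr_ge0//.
  by rewrite mulrC ler_wpM2r// (le_trans FxM)// ler_norm.
by rewrite lte_mul_pinfty.
Qed.

Lemma weighted_sumE F : nonneg_bounded F ->
  ((weighted_sum w F)%:E = \esum_(x in [set: T]) (w x * F x)%:E)%E.
Proof. by move=> bF; rewrite /weighted_sum fineK// esum_weighted_fin. Qed.

Lemma weighted_sumD F G : nonneg_bounded F -> nonneg_bounded G ->
  weighted_sum w (fun x => F x + G x) = weighted_sum w F + weighted_sum w G.
Proof.
move=> bF bG; apply: EFin_inj.
rewrite EFinD !weighted_sumE//; last exact: nonneg_boundedD.
rewrite -esumD => [||]; last 2 first.
- by move=> x _; rewrite lee_fin mulr_ge0// nonneg_bounded_ge0.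
- by move=> x _; rewrite lee_fin mulr_ge0// nonneg_bounded_ge0.
by apply: eq_esum => x _; rewrite mulrDr EFinD.
Qed.

Lemma weighted_sumZ (k : R) F : 0 <= k -> nonneg_bounded F ->
  weighted_sum w (fun x => k * F x) = k * weighted_sum w F.
Proof.
move=> k0 bF; apply: EFin_inj.
rewrite EFinM !weighted_sumE//; last exact: nonneg_boundedZ.
rewrite -esumZl//; last by move=> x; rewrite mulr_ge0// nonneg_bounded_ge0.
by apply: eq_esum => x _; rewrite mulrCA.
Qed.

Lemma weighted_sum_sum (I : Type) (r : seq I) (F : I -> T -> R) :
  (forall i, nonneg_bounded (F i)) ->
  weighted_sum w (fun x => \sum_(i <- r) F i x) =
  \sum_(i <- r) weighted_sum w (F i).
Proof.
move=> bF; elim: r => [|i r IH].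
  rewrite big_nil /weighted_sum esum1// => x _.
  by rewrite big_nil mulr0.
rewrite big_cons -IH -weighted_sumD//; last exact: nonneg_bounded_sum.
by congr weighted_sum; apply/funext => x; rewrite big_cons.
Qed.

Lemma ler_weighted_sum_supp F G : nonneg_bounded F -> nonneg_bounded G ->
  (forall x, 0 < w x -> F x <= G x) -> weighted_sum w F <= weighted_sum w G.
Proof.
move=> bF bG FG; rewrite -lee_fin !weighted_sumE//.
apply: le_esum => x _; rewrite lee_fin.
have := w0 x; rewrite le_eqVlt => /predU1P[<-|wx]; first by rewrite !mul0r.
by rewrite ler_wpM2l// FG.
Qed.

Lemma ler_weighted_sum F G : nonneg_bounded F -> nonneg_bounded G ->
  (forall x, F x <= G x) -> weighted_sum w F <= weighted_sum w G.
Proof. by move=> bF bG FG; apply: ler_weighted_sum_supp. Qed.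

Lemma weighted_sum_ge0 F : nonneg_bounded F -> 0 <= weighted_sum w F.
Proof.
move=> bF; rewrite -lee_fin weighted_sumE//; apply: esum_ge0 => x _.
by rewrite lee_fin mulr_ge0// nonneg_bounded_ge0.
Qed.

Lemma weighted_sum_ge_seq F (X : seq T) : uniq X -> nonneg_bounded F ->
  \sum_(x <- X) w x * F x <= weighted_sum w F.
Proof.
move=> uX bF; rewrite -lee_fin weighted_sumE//; apply: esum_ge.
exists [set` X]; first by split.
by rewrite -fsbig_seq// sumEFin.
Qed.

Lemma weighted_sum_ge F x : nonneg_bounded F -> w x * F x <= weighted_sum w F.
Proof.
by move=> bF; have := weighted_sum_ge_seq (X := [:: x]) isT bF; rewrite big_seq1.
Qed.

(** The finite set [X] depends on [w] and [e] only. One set thus serves a whole family of functions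
    with a common bound, which plays the part of dominated convergence in the limits below. *)
Lemma weighted_tail (e : R) : 0 < e -> exists X : seq T,
  uniq X /\ forall F M, 0 <= M -> (forall x, 0 <= F x <= M) ->
    weighted_sum w F <= \sum_(x <- X) w x * F x + M * e.
Proof.
move=> e0; have b1 : nonneg_bounded (fun=> 1 : R) by exists 1 => x; rewrite ler01 lexx.
have wfn : \esum_(x in [set: T]) (w x)%:E \is a fin_num.
  by rewrite ge0_fin_numE// esum_ge0// => x _; rewrite lee_fin.
have [_ [X [finX _] <-] Xe] := ub_ereal_sup_adherent e0 wfn.
exists (finmap.enum_fset (fset_set X)); split; first exact: finmap.fset_uniq.
move=> F M M0 FM; have bF : nonneg_bounded F by exists M.
rewrite -lee_fin weighted_sumE// (esumID X); last first.
  by move=> x _; rewrite lee_fin mulr_ge0// nonneg_bounded_ge0.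
rewrite setTI esum_fset//; last first.
  by move=> x _; rewrite lee_fin mulr_ge0// nonneg_bounded_ge0.
rewrite EFinD -sumEFin fsbig_finite//=; apply: leeD => //.
apply: (@le_trans _ _ (M%:E * \esum_(x in ~` X) (w x)%:E)%E).
  rewrite -esumZl// setTI; apply: le_esum => x _.
  by rewrite lee_fin mulrC ler_wpM2r//; have /andP[] := FM x.
rewrite EFinM lee_wpmul2l ?lee_fin//.
have : (\esum_(x in [set: T]) (w x)%:E - e%:E < \sum_(x \in X) (w x)%:E)%E by exact: Xe.
rewrite (esumID X)//; last by move=> x _; rewrite lee_fin.
rewrite !setTI esum_fset//; last by move=> x _; rewrite lee_fin.
have : (0 <= \esum_(x in ~` X) (w x)%:E)%E by apply: esum_ge0 => x _; rewrite lee_fin.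
rewrite fsbig_finite//= sumEFin.
case: (\esum_(x in ~` X) (w x)%:E)%E => [t| |]//=.
rewrite -!EFinD lte_fin !lee_fin => _.
by rewrite -addrA gtrDl subr_lt0 => /ltW.
Qed.

End weighted_sums.

(** * Attractive networks with a reservoir *)

Lemma sum_option (V : nmodType) (I : finType) (F : option I -> V) :
  \sum_a F a = F None + \sum_i F (Some i).
Proof.
rewrite (bigD1 None)//= (reindex_omap Some id)/=; last by case.
by congr (_ + _); apply: eq_bigl => i; rewrite eqxx.
Qed.

Section network.
Context {R : realType} {I : finType}.
Implicit Types (eta zeta : I -> natbar) (F : (I -> natbar) -> R) (a b : option I).

(* The vertex [None] is a reservoir holding infinitely many particles. *)
Definition transfer a b eta : I -> natbar :=
  fun i => omap (fun n => (n - (Some i == a) + (Some i == b))%N) (eta i).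

Definition nondecreasing_state F := forall eta zeta,
  (forall i, le_natbar (eta i) (zeta i)) -> F eta <= F zeta.

Lemma le_transfer a b eta zeta : (forall i, le_natbar (eta i) (zeta i)) ->
  forall i, le_natbar (transfer a b eta i) (transfer a b zeta i).
Proof.
move=> le_ez i; move: (le_ez i); rewrite /transfer.
case: (eta i) => [m|]; case: (zeta i) => [n|] //=.
by move=> mn; rewrite leq_add2r leq_sub2r.
Qed.

Variable g : nat -> R.
Hypothesis hg : jump_rate g.

Lemma rate_le1 n : g n <= 1.
Proof.
have [_ gmono _ _ g1] := hg; rewrite -(cvg_lim _ g1)//.
by apply: nondecreasing_cvgn_le; [move=> m k; exact: gmono|apply/cvg_ex; exists 1].
Qed.

Lemma extend_rate_itv n : 0 <= extend_rate g n <= 1.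
Proof.
have [g0 _ _ _ _] := hg.
by case: n => [n|] /=; rewrite ?g0 ?rate_le1// ler01 lexx.
Qed.

Definition departure a eta : R := if a is Some i then extend_rate g (eta i) else 1.

Lemma departure_itv a eta : 0 <= departure a eta <= 1.
Proof. by case: a => [i|] /=; rewrite ?extend_rate_itv// ler01 lexx. Qed.

Lemma le_departure a eta zeta : (forall i, le_natbar (eta i) (zeta i)) ->
  departure a eta <= departure a zeta.
Proof.
have [_ gmono _ _ _] := hg; case: a => [i /(_ i)|] //=.
case: (eta i) => [m|]; case: (zeta i) => [n|] //= mn; first exact: gmono.
exact: rate_le1.
Qed.

Lemma departure_lt a b eta zeta : (forall i, le_natbar (eta i) (zeta i)) ->
  departure a eta < departure a zeta ->
  forall i, le_natbar (eta i) (transfer a b zeta i).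
Proof.
case: a => [i|] le_ez; rewrite /departure ?ltxx// => lt_ez j.
rewrite /transfer; move: (le_ez j).
have [->|] := eqVneq j i; last first.
  move=> ji; case: (eta j) => [m|]; case: (zeta j) => [n|] //=.
  rewrite (_ : Some j == Some i = false) ?subn0; first lia.
  by apply/eqP => -[]; apply/eqP.
move: lt_ez; case: (eta i) => [m|]; case: (zeta i) => [n|] //=.
rewrite eqxx => gmn mn; have : m != n by apply: contraTneq gmn => ->; rewrite ltxx.
lia.
Qed.

Variable Q : option I * option I -> R.
Hypothesis Q0 : forall e, 0 <= Q e.

(** The factor 2 keeps the probability of moving at most 1/2, the laziness on which
    [network_step_sqr] rests; the summand 1 keeps the rate positive when all of [Q] vanishes. *)
Definition clock_rate : R := 1 + 2 * \sum_e Q e.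

Lemma clock_rate_gt0 : 0 < clock_rate.
Proof.
have : 0 <= \sum_e Q e by exact: sumr_ge0.
rewrite /clock_rate; lra.
Qed.

(** One step of the uniformized chain: clock [e] rings with probability [Q e / clock_rate], and its
    jump is accepted with probability [departure e.1 eta]. Multiplied by [clock_rate], the increment
    [network_step F - F] is the generator of the network. *)
Definition network_step F eta : R :=
  F eta + \sum_e (Q e / clock_rate) * departure e.1 eta *
          (F (transfer e.1 e.2 eta) - F eta).

Definition jump_prob e eta : R := Q e / clock_rate * departure e.1 eta.

Lemma jump_prob_ge0 e eta : 0 <= jump_prob e eta.
Proof.
have /andP[d0 _] := departure_itv e.1 eta.
by rewrite mulr_ge0// divr_ge0// ltW// clock_rate_gt0.
Qed.

Lemma sum_clock : \sum_e Q e / clock_rate <= 1 / 2.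
Proof.
have K0 := clock_rate_gt0.
rewrite -mulr_suml ler_pdivrMr// /clock_rate.
have : 0 <= \sum_e Q e by exact: sumr_ge0.
lra.
Qed.

Lemma sum_jump_prob eta : \sum_e jump_prob e eta <= 1 / 2.
Proof.
apply: le_trans sum_clock; apply: ler_sum => e _.
have /andP[_ d1] := departure_itv e.1 eta.
by rewrite ler_piMr// divr_ge0// ltW// clock_rate_gt0.
Qed.

Lemma network_stepE F eta : network_step F eta =
  (1 - \sum_e jump_prob e eta) * F eta +
  \sum_e jump_prob e eta * F (transfer e.1 e.2 eta).
Proof.
rewrite /network_step mulrBl mul1r mulr_suml -addrA; congr (_ + _).
rewrite -sumrN -big_split/=; apply: eq_bigr => e _.
rewrite /jump_prob; ring.
Qed.

Lemma network_step_itv F M : (forall eta, 0 <= F eta <= M) ->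
  forall eta, 0 <= network_step F eta <= M.
Proof.
move=> FM eta; rewrite network_stepE.
have s1 := sum_jump_prob eta.
have Fe eta' : 0 <= F eta' by have /andP[] := FM eta'.
have Fm eta' : F eta' <= M by have /andP[] := FM eta'.
apply/andP; split.
  rewrite addr_ge0// ?mulr_ge0//; first lra.
  by apply: sumr_ge0 => e _; rewrite mulr_ge0// jump_prob_ge0.
apply: (@le_trans _ _ ((1 - \sum_e jump_prob e eta) * M +
                       \sum_e jump_prob e eta * M)).
  apply: lerD; first by rewrite ler_wpM2l//; lra.
  by apply: ler_sum => e _; rewrite ler_wpM2l// jump_prob_ge0.
rewrite -mulr_suml; lra.
Qed.

(* Attractiveness: if a particle leaves the larger configuration only, the
   larger configuration had strictly more particles at the departure site. *)
Lemma nondecreasing_network_step F :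
  nondecreasing_state F -> nondecreasing_state (network_step F).
Proof.
move=> Fmono eta zeta le_ez.
(* In this form the choice of the clock is common to [eta] and [zeta]; only the acceptance depends
   on the configuration. *)
have stepE xi : network_step F xi = (1 - \sum_e Q e / clock_rate) * F xi +
    \sum_e Q e / clock_rate * ((1 - departure e.1 xi) * F xi +
       departure e.1 xi * F (transfer e.1 e.2 xi)).
  rewrite /network_step mulrBl mul1r mulr_suml -addrA; congr (_ + _).
  rewrite -sumrN -big_split/=; apply: eq_bigr => e _; ring.
rewrite !stepE; have s1 := sum_clock.
apply: lerD; first by rewrite ler_wpM2l ?Fmono//; lra.
apply: ler_sum => e _; apply: ler_wpM2l.
  by rewrite divr_ge0// ltW// clock_rate_gt0.
have /andP[d0 _] := departure_itv e.1 eta.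
have /andP[_ d1] := departure_itv e.1 zeta.
have de := le_departure e.1 le_ez.
have Fe := Fmono _ _ le_ez.
have Ft := Fmono _ _ (le_transfer e.1 e.2 le_ez).
have := de; rewrite le_eqVlt => /predU1P[->|/departure_lt -/(_ e.2 le_ez)].
  apply: lerD; first by rewrite ler_wpM2l//; lra.
  by rewrite ler_wpM2l//; lra.
move=> /Fmono Fl.
move: d0 d1 de Fe Ft Fl.
move: (departure _ eta) (departure _ zeta) (F eta) (F zeta)
  (F (transfer _ _ eta)) (F (transfer _ _ zeta)) => u v A B C D.
move=> u0 v1 uv AB CD AD.
(* The coupled outcomes: no jump with weight [1 - v], a jump in the larger configuration alone with
   weight [v - u], a jump in both with weight [u]. *)
have h1 : 0 <= (1 - v) * (B - A) by apply: mulr_ge0; lra.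
have h2 : 0 <= (v - u) * (D - A) by apply: mulr_ge0; lra.
have h3 : 0 <= u * (D - C) by apply: mulr_ge0; lra.
nra.
Qed.

(* The kernel stays put with probability at least 1/2, hence a quantitative
   Jensen inequality. *)
Lemma network_step_sqr F eta :
  network_step F eta ^+ 2 +
    3^-1 * \sum_e jump_prob e eta * (F (transfer e.1 e.2 eta) - F eta) ^+ 2 <=
  network_step (fun xi => F xi ^+ 2) eta.
Proof.
set q := fun e => jump_prob e eta.
set D := fun e => F (transfer e.1 e.2 eta) - F eta.
have q0 e : 0 <= q e by exact: jump_prob_ge0.
have q1 : \sum_e q e <= 1 / 2 by exact: sum_jump_prob.
have -> : network_step F eta = F eta + \sum_e q e * D e by [].
have -> : network_step (fun xi => F xi ^+ 2) eta =
    F eta ^+ 2 + (2 * F eta * (\sum_e q e * D e) + \sum_e q e * D e ^+ 2).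
  rewrite /network_step mulr_sumr -big_split/=; congr (_ + _).
  apply: eq_bigr => e _; rewrite /q /D /jump_prob; ring.
set m := \sum_e q e * D e.
have -> : \sum_e jump_prob e eta * (F (transfer e.1 e.2 eta) - F eta) ^+ 2 =
  \sum_e q e * D e ^+ 2 by [].
(* As [q] has mass at most 1/2, expanding gives (3/2) m^2 <= [\sum_e q e * D e ^+ 2]. So m^2 uses up
   at most two thirds of that sum, and the remaining third is the constant [3^-1]. *)
have : 0 <= \sum_e q e * (D e - m) ^+ 2.
  by apply: sumr_ge0 => e _; rewrite mulr_ge0// sqr_ge0.
have -> : \sum_e q e * (D e - m) ^+ 2 =
    \sum_e q e * D e ^+ 2 - 2 * m * m + m ^+ 2 * \sum_e q e.
  have qD e : q e * (D e - m) ^+ 2 =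
    q e * D e ^+ 2 + (- (2 * m)) * (q e * D e) + m ^+ 2 * q e by ring.
  under eq_bigr do rewrite qD.
  by rewrite !big_split/= -!mulr_sumr -/m; ring.
set s := \sum_e q e * D e ^+ 2 => hs.
have : m ^+ 2 * \sum_e q e <= m ^+ 2 * (1 / 2) by rewrite ler_wpM2l ?sqr_ge0.
rewrite sqrrD; move: hs; move: (\sum_e q e) => t; nra.
Qed.

Definition evolution F n := iter n network_step F.

Lemma evolution_itv F M : (forall eta, 0 <= F eta <= M) ->
  forall n eta, 0 <= evolution F n eta <= M.
Proof.
move=> FM; elim=> [|n IH] eta; first exact: FM.
by rewrite /evolution iterS; exact: network_step_itv.
Qed.

Lemma nondecreasing_evolution F : nondecreasing_state F ->
  forall n, nondecreasing_state (evolution F n).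
Proof.
move=> Fmono; elim=> [//|n IH].
by rewrite /evolution iterS; exact: nondecreasing_network_step.
Qed.

End network.

(** * Equilibrium of the network *)

Section product_sums.
Context {R : realType} {I : finType}.

Definition upd (xi : {ffun I -> nat}) (i : I) (n : nat) : {ffun I -> nat} :=
  [ffun j => if j == i then n else xi j].

(** Coordinates outside [r] are pinned to 0, so that adding a coordinate to [r] amounts to a
    bijection with pairs, and the sum over pairs factorizes. *)
Lemma esum_prod_seq (r : seq I) (A : I -> set nat) (v : I -> nat -> R)
    (V : I -> R) : uniq r -> (forall i n, 0 <= v i n) ->
  (forall i, (\esum_(n in A i) (v i n)%:E = (V i)%:E)%E) ->
  (\esum_(xi in [set xi : {ffun I -> nat} |
      forall i, if i \in r then A i (xi i) else xi i = 0%N])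
      (\prod_(i <- r) v i (xi i))%:E = (\prod_(i <- r) V i)%:E)%E.
Proof.
move=> + v0 vV; elim: r => [_|i r IH /= /andP[ir ur]].
  rewrite (_ : [set _ | _] = [set [ffun=> 0%N]]).
    by rewrite esum_set1 !big_nil ?lee_fin.
  apply/seteqP; split => [xi /= xi0|_ -> j] /=; last by rewrite ffunE.
  by apply/ffunP => j; rewrite ffunE; exact: xi0.
set B := [set xi : {ffun I -> nat} |
  forall i, if i \in r then A i (xi i) else xi i = 0%N].
rewrite (@reindex_esum _ _ _ (A i `*`` (fun=> B)) _
  (fun nx : nat * {ffun I -> nat} => upd nx.2 i nx.1)); last first.
  split.
  - move=> [n xi] /= [An Bxi] j; rewrite in_cons ffunE.
    by have [->//|ji /=] := eqVneq j i; exact: Bxi.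
  - move=> [n xi] [m zeta] /set_mem[/= _ Bxi] /set_mem[/= _ Bzeta] /ffunP e.
    have := e i; rewrite !ffunE eqxx => ->; congr (_, _); apply/ffunP => j.
    have [->|ji] := eqVneq j i.
      by have := Bxi i; have := Bzeta i; rewrite (negbTE ir) => -> ->.
    by have := e j; rewrite !ffunE (negbTE ji).
  - move=> xi /= Hxi; exists (xi i, upd xi i 0%N) => /=.
      split => /=; first by have := Hxi i; rewrite mem_head.
      move=> j; rewrite ffunE.
      have [->|ji] := eqVneq j i; first by rewrite (negbTE ir).
      by have := Hxi j; rewrite in_cons (negbTE ji).
    by apply/ffunP => j; rewrite !ffunE; case: eqVneq => // ->.
transitivity (\esum_(nx in A i `*`` (fun=> B))
    (v i nx.1 * \prod_(j <- r) v j (nx.2 j))%:E)%E.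
  apply: eq_esum => -[n xi] /= _; rewrite big_cons ffunE eqxx; congr (_ * _)%:E.
  apply: eq_big_seq => j jr; rewrite ffunE ifF//.
  by apply: contraNF ir => /eqP <-.
rewrite -(@esum_esum _ nat {ffun I -> nat} (A i) (fun=> B)
  (fun n xi => (v i n * \prod_(j <- r) v j (xi j))%:E)).
  under eq_esum => n _.
    rewrite esumZl//; last by move=> xi; apply: prodr_ge0.
    rewrite IH// muleC.
    over.
  have VV0 : 0 <= \prod_(j <- r) V j.
    apply: prodr_ge0 => j _; rewrite -lee_fin -vV.
    by apply: esum_ge0 => n _; rewrite lee_fin.
  under eq_esum do rewrite -EFinM.
  by rewrite esumZl// vV big_cons -EFinM mulrC.
by move=> n xi _ _; rewrite lee_fin mulr_ge0// prodr_ge0.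
Qed.

Lemma esum_prod (A : I -> set nat) (v : I -> nat -> R) (V : I -> R) :
  (forall i n, 0 <= v i n) ->
  (forall i, (\esum_(n in A i) (v i n)%:E = (V i)%:E)%E) ->
  (\esum_(xi in [set xi : {ffun I -> nat} | forall i, A i (xi i)])
      (\prod_i v i (xi i))%:E = (\prod_i V i)%:E)%E.
Proof.
move=> v0 vV.
rewrite -(esum_prod_seq (r := index_enum I) (index_enum_uniq I) v0 vV).
congr esum; apply/seteqP; split => xi /= H i; first by rewrite mem_index_enum.
by have := H i; rewrite mem_index_enum.
Qed.

End product_sums.

(** * Summability of the one-site weights *)

Section partition_function.
Context {R : realType}.
Variable g : nat -> R.
Hypothesis hg : jump_rate g.

Lemma rate_gt0 n : 0 < g n.+1.
Proof. by have [_ gm _ g1 _] := hg; apply: lt_le_trans g1 _; exact: gm. Qed.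

Lemma gfactS n : gfact g n.+1 = gfact g n * g n.+1.
Proof. by rewrite /gfact big_nat_recr. Qed.

Lemma gfact_gt0 n : 0 < gfact g n.
Proof.
elim: n => [|n IH]; first by rewrite /gfact big_nil.
by rewrite gfactS mulr_gt0// rate_gt0.
Qed.

Definition theta_weight (l : R) n := l ^+ n / gfact g n.

Lemma theta_weight_ge0 l n : 0 <= l -> 0 <= theta_weight l n.
Proof. by move=> l0; rewrite divr_ge0 ?exprn_ge0// ltW// gfact_gt0. Qed.

Lemma theta_weight_gt0 l n : 0 < l -> 0 < theta_weight l n.
Proof. by move=> l0; rewrite divr_gt0 ?exprn_gt0// gfact_gt0. Qed.

(** Ratio test: successive terms have ratio [l / g n.+1], eventually below the midpoint [q] of [l]
    and 1 because [g] tends to 1. The constant [C] takes care of the first terms. *)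
Lemma is_cvg_theta_weight l : 0 <= l < 1 -> cvgn (series (theta_weight l)).
Proof.
move=> /andP[l0 l1]; set q := (1 + l) / 2.
have q0 : 0 < q by rewrite /q; lra.
have q1 : q < 1 by rewrite /q; lra.
have lq : l / q < 1 by rewrite ltr_pdivrMr// /q; lra.
have [_ _ _ _ gcvg] := hg.
have [n1 _ gn1] : \forall n \near \oo, l / q < g n by exact: cvgr_gt gcvg _ lq.
pose C := \sum_(k < n1.+1) theta_weight l k / q ^+ k.
have th n : theta_weight l n <= C * q ^+ n.
  have [nn1|] := leqP n n1.
    rewrite -ler_pdivrMr ?exprn_gt0// /C (bigD1 (Ordinal (nn1 : (n < n1.+1)%N)))//=.
    by rewrite lerDl sumr_ge0// => k _; rewrite divr_ge0 ?theta_weight_ge0// exprn_ge0// ltW.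
  elim: n => // n IH; rewrite ltnS => nn1.
  have {}IH : theta_weight l n <= C * q ^+ n.
    move: nn1; rewrite leq_eqVlt => /predU1P[<-|/IH//].
    rewrite -ler_pdivrMr ?exprn_gt0// /C (bigD1 (@ord_max n1))//=.
    by rewrite lerDl sumr_ge0// => k _; rewrite divr_ge0 ?theta_weight_ge0// exprn_ge0// ltW.
  have -> : theta_weight l n.+1 = theta_weight l n * (l / g n.+1).
    rewrite /theta_weight exprS gfactS; field.
    by rewrite !gt_eqF ?gfact_gt0 ?rate_gt0.
  rewrite exprSr [leRHS]mulrA; apply: ler_pM => //.
  - by rewrite theta_weight_ge0.
  - by rewrite divr_ge0// ltW// rate_gt0.
  rewrite ler_pdivrMr ?rate_gt0// mulrC -ler_pdivrMr//.
  by apply/ltW/gn1 => /=; rewrite (leq_trans nn1).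
apply: (@series_le_cvg _ _ (fun n => C * q ^+ n)) => //.
- by move=> n; rewrite theta_weight_ge0.
- by move=> n; rewrite (le_trans _ (th n))// theta_weight_ge0.
- by apply: is_cvg_geometric_series; rewrite gtr0_norm.
Qed.

Lemma esum_theta_weight l : 0 <= l < 1 ->
  (\esum_(n in [set: nat]) (theta_weight l n)%:E = (partition_fun g l)%:E)%E.
Proof.
move=> l01; have /andP[l0 _] := l01.
rewrite -nneseries_esumT => [|n]; last by rewrite lee_fin theta_weight_ge0.
rewrite /partition_fun -EFin_lim; last exact: is_cvg_theta_weight.
congr (limn _); apply/funext => n /=; rewrite sumEFin.
by rewrite /series/=.
Qed.

Lemma partition_fun_gt0 l : 0 <= l < 1 -> 0 < partition_fun g l.
Proof.
move=> l01; have /andP[l0 _] := l01.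
apply: lt_le_trans (_ : theta_weight l 0 <= _).
  by rewrite /theta_weight expr0 /gfact big_nil divr1.
rewrite -lee_fin -esum_theta_weight//; apply: esum_ge; exists [set 0%N].
  by split.
by rewrite fsbig_set1.
Qed.

End partition_function.

(** * Superstationarity of the product weight *)

Section network_equilibrium.
Context {R : realType} {I : finType}.
Variable g : nat -> R.
Hypothesis hg : jump_rate g.
Variable Q : option I * option I -> R.
Hypothesis Q0 : forall e, 0 <= Q e.
Variable phi : I -> R.
Hypothesis phi01 : forall i, 0 < phi i < 1.

Implicit Types (xi : {ffun I -> nat}) (F H : (I -> natbar) -> R).

Let phi_itv i : 0 <= phi i < 1.
Proof. by have /andP[/ltW-> ->] := phi01 i. Qed.

Definition state xi : I -> natbar := fun i => Some (xi i).

(** Left unnormalized; its total mass, the product of the partition functions, is the factor that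
    appears in [evolution_limsup]. *)
Definition weight xi : R := \prod_i theta_weight g (phi i) (xi i).

Lemma weight_gt0 xi : 0 < weight xi.
Proof.
by apply: prodr_gt0 => i _; apply: theta_weight_gt0 => //; have /andP[] := phi01 i.
Qed.

Let weight_ge0 xi : 0 <= weight xi.
Proof. exact/ltW/weight_gt0. Qed.

Lemma esum_weight :
  (\esum_(xi in [set: {ffun I -> nat}]) (weight xi)%:E =
   (\prod_i partition_fun g (phi i))%:E)%E.
Proof.
rewrite -(@esum_prod _ _ (fun=> setT) (fun i n => theta_weight g (phi i) n)).
- by congr esum; apply/seteqP; split.
- by move=> i n; apply: theta_weight_ge0 => //; have /andP[/ltW] := phi01 i.
- by move=> i; apply: esum_theta_weight.
Qed.

Let weight_fin : (\esum_(xi in [set: {ffun I -> nat}]) (weight xi)%:E < +oo)%E.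
Proof. by rewrite esum_weight ltry. Qed.

Definition equilibrium F : R := weighted_sum weight (F \o state).

Definition incr (a : option I) xi : {ffun I -> nat} :=
  [ffun i => (xi i + (Some i == a))%N].

Lemma incr_None xi : incr None xi = xi.
Proof. by apply/ffunP => i; rewrite ffunE addn0. Qed.

Lemma transfer_incr a b xi :
  transfer a b (state (incr a xi)) = state (incr b xi).
Proof.
by apply/funext => i; rewrite /transfer /state !ffunE /= addnK.
Qed.

(** The recursion theta(n+1) g(n+1) = phi theta(n) at site [i]: a departure rate is traded for a
    factor [phi i]. *)
Lemma weight_incr i xi :
  weight (incr (Some i) xi) * g (xi i).+1 = phi i * weight xi.
Proof.
rewrite /weight (bigD1 i)//= [in RHS](bigD1 i)//=.
rewrite ffunE eqxx addn1 mulrAC mulrA.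
congr (_ * _); last first.
  apply: eq_bigr => j ji; rewrite ffunE (_ : Some j == _ = false) ?addn0//.
  by apply/eqP => -[/eqP]; rewrite (negbTE ji).
rewrite /theta_weight exprS gfactS; field.
by rewrite !gt_eqF ?gfact_gt0 ?rate_gt0.
Qed.

Lemma departure_state_ge0 a xi : 0 <= departure g a (state xi) <= 1.
Proof. exact: departure_itv. Qed.

Lemma nonneg_bounded_departure a G : nonneg_bounded G ->
  nonneg_bounded (fun xi => departure g a (state xi) * G xi).
Proof.
by apply: nonneg_boundedM; exists 1 => xi; exact: departure_state_ge0.
Qed.

(** The value 1 at the reservoir corresponds to lambda = alpha on the sources. *)
Definition fugacity (a : option I) : R := if a is Some i then phi i else 1.

(* Every family of transitions leaving [a] is reindexed by the configuration
   deprived of the moving particle. *)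
Lemma weighted_sum_departure a (G : {ffun I -> nat} -> R) : nonneg_bounded G ->
  weighted_sum weight (fun xi => departure g a (state xi) * G xi) =
  fugacity a * weighted_sum weight (G \o incr a).
Proof.
move=> bG; case: a => [i|]; last first.
  rewrite mul1r; congr weighted_sum; apply/funext => xi /=.
  by rewrite mul1r incr_None.
have bGi := nonneg_bounded_comp (incr (Some i)) bG.
apply: EFin_inj; rewrite EFinM !weighted_sumE//; last exact: nonneg_bounded_departure.
rewrite -esumZl; last 2 first.
- by have /andP[/ltW] := phi01 i.
- by move=> xi; rewrite mulr_ge0// (nonneg_bounded_ge0 _ bGi).
have [g0 _ g00 _ _] := hg.
(* Since [g 0 = 0], configurations empty at [i] drop out, and [incr (Some i)] is a bijection onto
   the others. *)
transitivity (\esum_(xi in [set xi : {ffun I -> nat} | (0 < xi i)%N])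
    (weight xi * (g (xi i) * G xi))%:E)%E.
  rewrite [RHS]esum_mkcond; apply: eq_esum => xi _ /=.
  case: ifPn => //; rewrite notin_setE/= => /negP; rewrite -leqNgt leqn0 => /eqP ->.
  by rewrite g00 mul0r mulr0.
rewrite (@reindex_esum _ _ _ setT _ (incr (Some i))).
  apply: eq_esum => xi _ /=; congr (_%:E).
  by rewrite mulrA mulrA -weight_incr ffunE eqxx addn1.
split.
- by move=> xi _ /=; rewrite ffunE eqxx addn1.
- move=> xi zeta _ _ /ffunP e; apply/ffunP => j.
  by have := e j; rewrite !ffunE => /eqP; rewrite eqn_add2r => /eqP.
- move=> xi /= xi0; exists [ffun j => (xi j - (Some j == Some i))%N] => //.
  apply/ffunP => j; rewrite !ffunE subnK//.
  by case: eqP => [[->]|].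
Qed.

(** Inflow is at most outflow. For [phi = lambda / alpha] and the rates of the network below, it
    says that the mean of lambda over one backward step is at most lambda at every vertex. *)
Hypothesis superharmonic : forall j,
  \sum_a fugacity a * Q (a, Some j) <= phi j * \sum_b Q (Some j, b).

(** Let [h b] be the weighted sum of [H] after a particle is added at [b]. Transitions from [a] to
    [b] change the mean in proportion to [fugacity a] times [h b - h a]. Collected at a site [j],
    the excess [h (Some j) - h None], nonnegative because [H] is nondecreasing, is multiplied by
    inflow minus outflow, which is nonpositive. *)
Lemma equilibrium_network_step H : nondecreasing_state H ->
  nonneg_bounded H -> equilibrium (network_step g Q H) <= equilibrium H.
Proof.
move=> Hmono bH.
have K0 := clock_rate_gt0 Q0.
have bHs := nonneg_bounded_comp state bH.
have [M HM] := bH.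
have bT : nonneg_bounded (network_step g Q H \o state).
  by exists M => xi /=; apply: network_step_itv.
pose q e : R := Q e / clock_rate Q.
have q0 e : 0 <= q e by rewrite /q divr_ge0// ltW.
pose out (e : option I * option I) xi := departure g e.1 (state xi) * H (state xi).
pose inn (e : option I * option I) xi :=
  departure g e.1 (state xi) * H (transfer e.1 e.2 (state xi)).
have bout e : nonneg_bounded (out e) by exact: nonneg_bounded_departure.
have binn e : nonneg_bounded (inn e).
  by apply: nonneg_bounded_departure; exists M.
have bq (G : option I * option I -> {ffun I -> nat} -> R) :
    (forall e, nonneg_bounded (G e)) ->
    nonneg_bounded (fun xi => \sum_e q e * G e xi).
  by move=> bG; apply: nonneg_bounded_sum => e; exact: nonneg_boundedZ.
(* Losses stand on the opposite side because the additivity of [weighted_sum] is available for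
   nonnegative functions. *)
have : equilibrium (network_step g Q H) +
    weighted_sum weight (fun xi => \sum_e q e * out e xi) =
    equilibrium H + weighted_sum weight (fun xi => \sum_e q e * inn e xi).
  rewrite -!weighted_sumD//; try exact: bq.
  congr weighted_sum; apply/funext => xi /=; rewrite /network_step -addrA.
  congr (_ + _); rewrite -big_split/=; apply: eq_bigr => e _.
  rewrite /q /out /inn; ring.
rewrite !(weighted_sum_sum weight_ge0 weight_fin); last 2 first.
- by move=> e; exact: nonneg_boundedZ.
- by move=> e; exact: nonneg_boundedZ.
have sumE G : (forall e, nonneg_bounded (G e)) ->
    \sum_e weighted_sum weight (fun xi => q e * G e xi) =
    \sum_e q e * weighted_sum weight (G e).
  by move=> bG; apply: eq_bigr => e _; rewrite weighted_sumZ.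
rewrite !sumE//.
pose h b := weighted_sum weight (H \o state \o incr b).
have outE e : weighted_sum weight (out e) = fugacity e.1 * h e.1.
  exact: weighted_sum_departure.
have innE e : weighted_sum weight (inn e) = fugacity e.1 * h e.2.
  rewrite (weighted_sum_departure e.1
    (G := fun xi => H (transfer e.1 e.2 (state xi)))); last by exists M.
  by congr (_ * weighted_sum _ _); apply/funext => xi /=; rewrite transfer_incr.
under eq_bigr do rewrite outE.
under [in RHS]eq_bigr do rewrite innE.
suff : \sum_e q e * (fugacity e.1 * h e.2) <= \sum_e q e * (fugacity e.1 * h e.1).
  move=> *; lra.
have hge b : h None <= h b.
  apply: ler_weighted_sum => //; [exact: nonneg_bounded_comp..|].
  move=> xi; apply: Hmono => i; rewrite /state/= !ffunE leq_add2l.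
  by case: (Some i == b).
(* The constant [h None] cancels, and as [k None = 0] the reservoir contributes neither as a target
   on the left nor as a source on the right. *)
pose k b := h b - h None.
have k0 b : 0 <= k b by rewrite subr_ge0.
suff : \sum_e Q e * (fugacity e.1 * k e.2) <= \sum_e Q e * (fugacity e.1 * k e.1).
  have split_k (s : option I * option I -> option I) :
     \sum_e q e * (fugacity e.1 * h (s e)) =
     (clock_rate Q)^-1 * \sum_e Q e * (fugacity e.1 * k (s e)) +
     \sum_e q e * (fugacity e.1 * h None).
    rewrite mulr_sumr -big_split/=; apply: eq_bigr => e _.
    by rewrite /q /k; ring.
  rewrite (split_k snd) (split_k fst) lerD2r => ?.
  by rewrite ler_wpM2l// invr_ge0 ltW.
have pairE (f : option I * option I -> R) : \sum_e f e = \sum_a \sum_b f (a, b).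
  by rewrite pair_bigA/=; apply: eq_bigr => -[].
rewrite !pairE [X in X <= _]exchange_big/= [X in X <= _]sum_option [X in _ <= X]sum_option/=.
have kN : k None = 0 by rewrite /k subrr.
rewrite big1 => [|a _]; last by rewrite kN !mulr0.
rewrite [X in _ <= X + _]big1 => [|a _]; last by rewrite kN !mulr0.
rewrite !add0r; apply: ler_sum => j _.
have -> : \sum_a Q (a, Some j) * (fugacity a * k (Some j)) =
    k (Some j) * \sum_a fugacity a * Q (a, Some j).
  by rewrite mulr_sumr; apply: eq_bigr => a _; ring.
have -> : \sum_b Q (Some j, b) * (phi j * k (Some j)) =
    k (Some j) * (phi j * \sum_b Q (Some j, b)).
  by rewrite !mulr_sumr; apply: eq_bigr => b _; ring.
by rewrite ler_wpM2l.
Qed.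

(** * Vanishing gradients and the limit of the iterates *)

Section convergence.
Variables (f : (I -> natbar) -> R) (M : R).
Hypotheses (fmono : nondecreasing_state f) (fM : forall eta, 0 <= f eta <= M).

Local Notation evolution := (evolution g Q).

Let F n := evolution f n.

Lemma equilibrium_evolution n : equilibrium (evolution f n) <= equilibrium f.
Proof.
elim: n => [//|n]; apply: le_trans.
apply: (equilibrium_network_step (H := evolution f n)).
  exact: (nondecreasing_evolution hg Q0 fmono).
by exists M => eta; exact: (evolution_itv hg Q0 fM).
Qed.

(* The L^2 norm of the iterates decreases, and its decrement controls the
   squared discrete gradient. *)
Lemma evolution_gradient_cvg e xi : 0 < Q e -> 0 < departure g e.1 (state xi) ->
  (fun n => evolution f n (transfer e.1 e.2 (state xi)) - evolution f n (state xi))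
    @ \oo --> 0.
Proof.
move=> Qe de.
pose D n := F n (transfer e.1 e.2 (state xi)) - F n (state xi).
pose N n := equilibrium (fun eta => F n eta ^+ 2).
have Fitv n eta : 0 <= F n eta <= M by exact: (evolution_itv hg Q0 fM).
have bsq n : nonneg_bounded (fun eta => F n eta ^+ 2).
  exists (M ^+ 2) => eta; have /andP[F0 F1] := Fitv n eta.
  by rewrite sqr_ge0/= lerXn2r ?nnegrE// (le_trans F0).
(* Nonnegativity makes the square nondecreasing, so that superstationarity applies to it. *)
have sqmono n : nondecreasing_state (fun eta => F n eta ^+ 2).
  move=> eta zeta le_ez; have /andP[F0 _] := Fitv n eta.
  have /andP[F0' _] := Fitv n zeta.
  by rewrite lerXn2r ?nnegrE//; exact: (nondecreasing_evolution hg Q0 fmono).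
pose c := 3^-1 * (weight xi * jump_prob g Q e (state xi)).
have c0 : 0 < c.
  rewrite /c mulr_gt0// mulr_gt0 ?weight_gt0// /jump_prob mulr_gt0//.
  by rewrite divr_gt0// clock_rate_gt0.
have Ndecr n : c * D n ^+ 2 <= N n - N n.+1.
  have := equilibrium_network_step (sqmono n) (bsq n).
  pose grad eta := \sum_e jump_prob g Q e eta *
    (F n (transfer e.1 e.2 eta) - F n eta) ^+ 2.
  have bgrad : nonneg_bounded (grad \o state).
    apply: nonneg_bounded_sum => e'; exists (1 * M ^+ 2) => zeta.
    have := jump_prob_ge0 hg Q0 e' (state zeta).
    have : jump_prob g Q e' (state zeta) <= 1.
      apply: (@le_trans _ _ (\sum_e jump_prob g Q e (state zeta))).
        rewrite (bigD1 e')//= lerDl sumr_ge0// => ? _; exact: jump_prob_ge0.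
      by apply: le_trans (sum_jump_prob hg Q0 _) _; lra.
    have := Fitv n (transfer e'.1 e'.2 (state zeta)).
    have := Fitv n (state zeta).
    move=> /andP[? ?] /andP[? ?] ? ?.
    rewrite mulr_ge0 ?sqr_ge0//= ler_pM ?sqr_ge0//; nra.
  have bS : nonneg_bounded ((fun eta => F n.+1 eta ^+ 2) \o state).
    exact: nonneg_bounded_comp.
  have bT : nonneg_bounded (network_step g Q (fun eta => F n eta ^+ 2) \o state).
    have [M2 HM2] := bsq n.
    by exists M2 => zeta; exact: network_step_itv.
  have b3 : nonneg_bounded (fun zeta => 3^-1 * (grad \o state) zeta).
    exact: nonneg_boundedZ.
  have : N n.+1 + 3^-1 * weighted_sum weight (grad \o state) <=
         equilibrium (network_step g Q (fun eta => F n eta ^+ 2)).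
    rewrite -weighted_sumZ// -weighted_sumD//.
    apply: ler_weighted_sum => //; first exact: nonneg_boundedD.
    by move=> zeta; exact: network_step_sqr.
  have : weight xi * grad (state xi) <= weighted_sum weight (grad \o state).
    exact: weighted_sum_ge.
  have : weight xi * (jump_prob g Q e (state xi) * D n ^+ 2) <=
      weight xi * grad (state xi).
    rewrite ler_wpM2l// /grad (bigD1 e)//= lerDl sumr_ge0// => ? _.
    by rewrite mulr_ge0 ?sqr_ge0// jump_prob_ge0.
  rewrite /c -/(N n); lra.
have Ncvg : cvgn N.
  apply: nonincreasing_is_cvgn.
    apply/nonincreasing_seqP => n; rewrite -subr_ge0.
    by apply: le_trans (Ndecr n); rewrite mulr_ge0 ?sqr_ge0// ltW.
  exists 0 => _ [n _ <-]; apply: weighted_sum_ge0 => //.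
  exact: nonneg_bounded_comp.
have dN : (fun n => N n - N n.+1) @ \oo --> 0.
  rewrite -(subrr (limn N)); apply: cvgB => //.
  by rewrite -(cvg_shiftS N) in Ncvg *.
have cD : (fun n => c * D n ^+ 2) @ \oo --> 0.
  apply: (squeeze_cvgr _ (cvg_cst 0) dN); apply: nearW => n.
  by rewrite Ndecr andbT mulr_ge0 ?sqr_ge0// ltW.
have D2 : (fun n => D n ^+ 2) @ \oo --> 0.
  rewrite -(mulr0 c^-1); under eq_cvg => n.
    rewrite (_ : D n ^+ 2 = c^-1 * (c * D n ^+ 2)); last first.
      by rewrite mulrA mulVf ?gt_eqF// mul1r.
    over.
  exact: cvgMl_tmp.
apply/cvgrPdist_lt => e0 e00.
move/cvgrPdist_lt: D2 => /(_ (e0 ^+ 2)) []; first by rewrite exprn_gt0.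
move=> n0 _ Hn; exists n0 => // n /Hn; rewrite !sub0r !normrN => H.
rewrite -(@ltr_pXn2r _ 2)// ?nnegrE//; last exact: ltW.
by move: H; rewrite normrX.
Qed.

(** Equivalently, every vertex is reached from the reservoir along transitions of positive rate;
    sets closed under predecessors avoid speaking of paths. *)
Hypothesis connected : forall C : pred I,
  (forall j, C j -> forall a, 0 < Q (a, Some j) -> exists2 i, a = Some i & C i) ->
  forall i, ~~ C i.

Let gap (xi zeta : {ffun I -> nat}) :=
  (fun n => evolution f n (state zeta) - evolution f n (state xi)) @ \oo --> 0.

Let gap_trans xi zeta chi : gap xi zeta -> gap zeta chi -> gap xi chi.
Proof.
move=> gxz gzc; rewrite /gap -[X in _ --> X](addr0 0).
under eq_cvg => n.
  rewrite (_ : _ - _ = (evolution f n (state zeta) - evolution f n (state xi)) +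
     (evolution f n (state chi) - evolution f n (state zeta))); last by ring.
  over.
exact: cvgD.
Qed.

(** [connected] is applied to the set of vertices where the claim fails. A vertex fed by the
    reservoir receives its extra particle in a single transition. If [i] feeds [j] and the claim
    holds at [i], a particle is added at [i] and then moved to [j]. *)
Let gap_incr i xi : gap xi (incr (Some i) xi).
Proof.
have := connected (C := fun i => ~~ `[< forall xi, gap xi (incr (Some i) xi) >]).
move=> /(_ _ i); rewrite negbK => conn; move: xi; apply/asboolP/conn => {i conn}.
move=> j /asboolPn jC a Qaj.
apply: contrapT => notC; apply: jC => xi.
case: a Qaj notC => [i|] Qaj notC; last first.
  have := evolution_gradient_cvg (e := (None, Some j)) (xi := xi) Qaj.
  rewrite /= -{1}(incr_None xi) transfer_incr; apply.
  exact: ltr01.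
have iA : forall zeta, gap zeta (incr (Some i) zeta).
  by apply: contrapT => iC; apply: notC; exists i => //; apply/asboolPn.
apply: (gap_trans (iA xi)).
have := evolution_gradient_cvg (e := (Some i, Some j)) (xi := incr (Some i) xi) Qaj.
rewrite /= transfer_incr; apply.
by rewrite ffunE eqxx addn1 rate_gt0.
Qed.

Let gap_zero xi : gap [ffun=> 0%N] xi.
Proof.
have [n le_n] := ubnP (\sum_i xi i)%N; elim: n xi le_n => // n IH xi le_n.
have [[i xi0]|xi0] := pselect (exists i, (0 < xi i)%N); last first.
  suff -> : xi = [ffun=> 0%N].
    by rewrite /gap; under eq_cvg do rewrite subrr; exact: cvg_cst.
  apply/ffunP => i; rewrite ffunE; apply/eqP; rewrite -leqn0 leqNgt.
  by apply/negP => ?; apply: xi0; exists i.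
pose zeta : {ffun I -> nat} := [ffun j => (xi j - (Some j == Some i))%N].
have xiE : xi = incr (Some i) zeta.
  apply/ffunP => j; rewrite !ffunE subnK//.
  by case: eqP => [[->]|].
move: le_n; rewrite xiE => le_n; apply: gap_trans (gap_incr i zeta); apply: IH.
move: le_n; suff -> : (\sum_j incr (Some i) zeta j = (\sum_j zeta j).+1)%N by [].
under eq_bigr do rewrite ffunE.
rewrite big_split/= -addn1; congr (_ + _)%N.
rewrite (bigD1 i)//= eqxx big1// => j ji.
by rewrite (_ : Some j == Some i = false)//; apply/eqP => -[/eqP]; rewrite (negbTE ji).
Qed.

(** The value of the iterate at [xi] exceeds that at [zeta] by at most [G n zeta], which is bounded
    by [M] and tends to 0 for each [zeta]. Summing against [weight] bounds it by the mean of the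
    iterate, hence of [f], up to a small error. *)
Lemma evolution_limsup xi e : 0 < e -> exists n0, forall n, (n0 <= n)%N ->
  evolution f n (state xi) * \prod_i partition_fun g (phi i) <= equilibrium f + e.
Proof.
move=> e0; set Z := \prod_i _.
have M0 : 0 <= M by have /andP[/le_trans] := fM (state xi); exact.
have Mp : 0 < M + 1 by lra.
(* [M + 1] avoids dividing by zero when [M = 0]. *)
have e1 : 0 < e / (2 * (M + 1)) by rewrite divr_gt0//; lra.
have [X [_ tailX]] := weighted_tail weight_ge0 weight_fin e1.
pose G n zeta := `|evolution f n (state xi) - evolution f n (state zeta)|.
have bG n zeta : 0 <= G n zeta <= M.
  rewrite normr_ge0/= ler_norml; have := evolution_itv hg Q0 fM n (state xi).
  have := evolution_itv hg Q0 fM n (state zeta); lra.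
have gapG zeta : (fun n => G n zeta) @ \oo --> 0.
  rewrite -(normr0 R); apply: cvg_norm.
  have : gap zeta xi.
    have := gap_zero xi; have := gap_zero zeta => /cvgN.
    rewrite oppr0 => gz gx; rewrite /gap -[X in _ --> X](addr0 0).
    under eq_cvg => n.
      rewrite (_ : _ - _ = (evolution f n (state xi) - evolution f n (state [ffun=> 0%N])) +
        - (evolution f n (state zeta) - evolution f n (state [ffun=> 0%N]))); last by ring.
      over.
    exact: cvgD.
  exact.
have sumG : (fun n => \sum_(zeta <- X) weight zeta * G n zeta) @ \oo --> 0.
  have /cvg_trans : (fun n => \sum_(zeta <- X) weight zeta * G n zeta) @ \oo -->
      \sum_(zeta <- X) weight zeta * (0 : R).
    apply: (@cvg_big _ _ +%R 0 xpredT (@add_continuous R)) => zeta _.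
    exact: cvgMl_tmp.
  by apply; rewrite big1// => zeta _; rewrite mulr0.
have e2 : 0 < e / 2 by rewrite divr_gt0.
have [n0 _ Hn0] : \forall n \near \oo, \sum_(zeta <- X) weight zeta * G n zeta < e / 2.
  exact: cvgr_lt sumG _ e2.
exists n0 => n /Hn0 /= sumn.
have bF : nonneg_bounded (evolution f n \o state).
  by exists M => zeta; exact: (evolution_itv hg Q0 fM).
have bGn : nonneg_bounded (G n) by exists M => zeta; exact: bG.
have bcst : nonneg_bounded (fun _ : {ffun I -> nat} => evolution f n (state xi) * 1).
  by exists M => zeta; rewrite mulr1; exact: (evolution_itv hg Q0 fM).
have Fxi0 : 0 <= evolution f n (state xi).
  by have /andP[] := evolution_itv hg Q0 fM n (state xi).
have b1 : nonneg_bounded (fun _ : {ffun I -> nat} => 1 : R).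
  by exists 1 => zeta; rewrite ler01 lexx.
have -> : evolution f n (state xi) * Z =
    weighted_sum weight (fun=> evolution f n (state xi) * 1).
  rewrite weighted_sumZ//; congr (_ * _); apply: EFin_inj.
  rewrite weighted_sumE// -esum_weight; apply: eq_esum => zeta _.
  by rewrite mulr1.
apply: (@le_trans _ _ (weighted_sum weight (fun zeta =>
    (evolution f n \o state) zeta + G n zeta))).
  apply: ler_weighted_sum => //; first exact: nonneg_boundedD.
  by move=> zeta; rewrite mulr1 -lerBlDl; exact: ler_norm.
rewrite weighted_sumD//; apply: lerD; first exact: equilibrium_evolution.
apply: (le_trans (tailX _ _ M0 (bG n))).
have : M * (e / (2 * (M + 1))) <= e / 2.
  have <- : (M + 1) * (e / (2 * (M + 1))) = e / 2 by field; rewrite gt_eqF.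
  by apply: ler_wpM2r; [exact: ltW|lra].
lra.
Qed.

End convergence.

End network_equilibrium.

(** * Comparison of the zero-range process with the network *)

Section configuration_topology.

Lemma nbhs_natbar_Some n (U : set natbar) : U (Some n) -> nbhs (Some n : natbar) U.
Proof.
move=> Un; change (nbhs n (Some @^-1` U)).
by rewrite nbhs_principalE; apply/principal_filterP.
Qed.

Lemma nbhs_natbar_None N (U : set natbar) : U None ->
  (forall n, (N <= n)%N -> U (Some n)) -> nbhs (None : natbar) U.
Proof.
move=> UN Un; exists `I_N.
  split; first exact: finite_compact.
  by apply: discrete_closed.
move=> [n|] [|]//= [m /negP]; rewrite -leqNgt => mN [<-]; exact: Un.
Qed.

(** Integers are isolated points of [natbar], so only the limit at [None] matters. *)
Lemma natbar_continuous (Y : topologicalType) (f : natbar -> Y) :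
  (fun n => f (Some n)) @ \oo --> f None -> continuous f.
Proof.
move=> fcvg [n|] U.
  by move=> /nbhs_singleton; exact: nbhs_natbar_Some.
move=> UN; have [N _ HN] := fcvg _ UN.
by apply: (nbhs_natbar_None (N := N)); [exact: nbhs_singleton|exact: HN].
Qed.

Lemma natbar_eventually_continuous (Y : topologicalType) (f : natbar -> Y) N :
  (forall n, (N <= n)%N -> f (Some n) = f None) -> continuous f.
Proof.
move=> fN; apply: natbar_continuous; apply: cvg_near_cst.
by exists N => // n /=; exact: fN.
Qed.

Lemma compact_nat_bounded (C : set nat) : compact C ->
  exists N, forall n, C n -> (n < N)%N.
Proof.
move=> /compact_near_coveringP/(_ nat \oo (fun N n => (n < N)%N)) cov.
have [N _ /(_ N (leqnn N)) CN] : \forall N \near \oo, C `<=` [eta ltn^~ N].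
  apply: cov => n _; exists ([set n], [set N | (n < N)%N]).
    by split; [rewrite nbhs_principalE; apply/principal_filterP|exists n.+1].
  by move=> [m N] /= [-> ].
by exists N => n /CN.
Qed.

Lemma omap_continuous (k : nat -> nat) : k @ \oo --> \oo ->
  continuous (omap k : natbar -> natbar).
Proof.
move=> kinf; apply: natbar_continuous => /= U [C [/compact_nat_bounded[N CN] _] CU].
have [M _ HM] : \forall n \near \oo, (N <= k n)%N by exact: (kinf _ (nbhs_infty_ge N)).
exists M => // n /= /HM Nk; apply: CU; left; exists (k n) => //.
by move=> /CN; rewrite ltnNge Nk.
Qed.

Lemma prod_topology_continuous (T : topologicalType) (J : Type)
    (K : J -> topologicalType) (f : T -> prod_topology K) :
  (forall j, continuous (fun x => f x j)) -> continuous f.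
Proof.
move=> fc x; apply/cvg_sup => j U [_/= [[W oW <-]]] /= Wfx /filterS; apply.
by apply: (fc j x); exact: open_nbhs_nbhs.
Qed.

End configuration_topology.

Section signed_sums.
Context {R : realType} {T : choiceType}.
Variable w : T -> R.
Hypothesis w0 : forall x, 0 <= w x.
Hypothesis wfin : (\esum_(x in [set: T]) (w x)%:E < +oo)%E.

(** The positive and negative parts of [A - B] need not be [A] and [B]; summability of [w] makes the
    two differences of sums agree. *)
Lemma real_sum_weighted (A B : T -> R) : nonneg_bounded A -> nonneg_bounded B ->
  real_sum (fun x => w x * (A x - B x)) = weighted_sum w A - weighted_sum w B.
Proof.
move=> bA bB.
pose a x := (w x * A x)%:E; pose b x := (w x * B x)%:E.
have a0 x : (0 <= a x)%E by rewrite lee_fin mulr_ge0// nonneg_bounded_ge0.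
have b0 x : (0 <= b x)%E by rewrite lee_fin mulr_ge0// nonneg_bounded_ge0.
have suma : summable setT a.
  rewrite /summable; under eq_esum do rewrite gee0_abs//.
  by rewrite -ge0_fin_numE ?esum_weighted_fin// esum_ge0.
have sumb : summable setT b.
  rewrite /summable; under eq_esum do rewrite gee0_abs//.
  by rewrite -ge0_fin_numE ?esum_weighted_fin// esum_ge0.
have abE x : (a \- b)%E x = (w x * (A x - B x))%:E.
  by rewrite /a /b/= -EFinB mulrBr.
have sumab := summableB suma sumb.
have posE : (\esum_(x in [set: T]) ((fun x => (w x * (A x - B x))%R)^\+%R x)%:E =
    \esum_(x in [set: T]) (a \- b)^\+ x)%E.
  by apply: eq_esum => x _; rewrite funeposE abE /funrpos EFin_max.
have negE : (\esum_(x in [set: T]) ((fun x => (w x * (A x - B x))%R)^\-%R x)%:E =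
    \esum_(x in [set: T]) (a \- b)^\- x)%E.
  by apply: eq_esum => x _; rewrite funenegE abE /funrneg EFin_max EFinN.
rewrite /real_sum posE negE -fineB.
- by rewrite esumB// fineB//; exact: esum_weighted_fin.
- have := summable_funepos sumab; rewrite summableE.
  by under eq_esum do rewrite gee0_abs//.
- have := summable_funeneg sumab; rewrite summableE.
  by under eq_esum do rewrite gee0_abs//.
Qed.

End signed_sums.

(** * Rates of the network and comparison of the generators *)

Section rates.
Context {R : realType} {d : nat} {I : finType}.
Variable pos : I -> site d.
Hypothesis pos_inj : injective pos.
Variables p alpha : site d -> R.
Hypothesis hp : jump_law p.
Hypothesis alpha01 : forall x, 0 <= alpha x <= 1.

Let p0 z : 0 <= p z. Proof. by have [] := hp. Qed.
Let alpha0 x : 0 <= alpha x. Proof. by have /andP[] := alpha01 x. Qed.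

Definition vertex (x : site d) : option I := [pick i | pos i == x].

Lemma vertex_pos i : vertex (pos i) = Some i.
Proof.
by rewrite /vertex; case: pickP => [j /eqP/pos_inj ->//|/(_ i)]; rewrite eqxx.
Qed.

Lemma vertex_Some x i : vertex x = Some i -> x = pos i.
Proof. by rewrite /vertex; case: pickP => // j /eqP <- [->]. Qed.

Definition outside : set (site d) := [set x | vertex x = None].

Lemma esum_vertex (u : site d -> R) : (forall x, 0 <= u x) ->
  (\esum_(x in [set: site d]) (u x)%:E =
   (\sum_i u (pos i))%:E + \esum_(x in outside) (u x)%:E)%E.
Proof.
move=> u0; rewrite (esumID (range pos)) ?setTI//; last first.
  by move=> x _; rewrite lee_fin.
congr (_ + _)%E; last first.
  congr esum; apply/seteqP; split => x /=.
    by move=> xI; rewrite /outside/= /vertex; case: pickP => // i /eqP xi; case: xI; exists i.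
  by move=> + [i _ xi]; rewrite /outside/= -xi vertex_pos.
rewrite esum_image; last by move=> i j _ _ /pos_inj.
rewrite (esum_fset finite_finset); last by move=> i _; rewrite lee_fin.
rewrite (fsbigE (index_enum I)) ?index_enum_uniq//; last first.
  by move=> i; rewrite mem_index_enum.
by rewrite -sumEFin; apply: eq_bigl => i; rewrite in_setT.
Qed.

Lemma esum_jump_law_to x : (\esum_(y in [set: site d]) (p (y - x))%:E = 1)%E.
Proof.
have [_ <-] := hp; rewrite [RHS](@reindex_esum _ _ _ setT _ (fun y => y - x))//.
split => //; first by move=> y z _ _ /addIr.
by move=> z _; exists (z + x); rewrite ?addrK.
Qed.

Lemma esum_jump_law_from y : (\esum_(x in [set: site d]) (p (y - x))%:E = 1)%E.
Proof.
have [_ <-] := hp; rewrite [RHS](@reindex_esum _ _ _ setT _ (fun x => y - x))//.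
split => //; first by move=> x z _ _ /addrI/oppr_inj.
by move=> z _; exists (y - z); rewrite ?subKr.
Qed.

Lemma esum_outside_to x :
  (\esum_(y in outside) (p (y - x))%:E = (1 - \sum_i p (pos i - x))%:E)%E.
Proof.
have := esum_vertex (u := fun y => p (y - x)) (fun=> p0 _).
rewrite esum_jump_law_to.
case: (esum outside _) => [r| |]//.
by rewrite -EFinD => -[h]; congr (_%:E); rewrite h addrAC subrr add0r.
Qed.

Lemma esum_outside_fin y :
  \esum_(x in outside) (alpha x * p (y - x))%:E \is a fin_num.
Proof.
rewrite ge0_fin_numE; last by apply: esum_ge0 => x _; rewrite lee_fin mulr_ge0.
apply: (@le_lt_trans _ _ 1%E); last exact: ltry.
rewrite -(esum_jump_law_from y) esum_mkcond; apply: le_esum => x _.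
case: ifPn => _; rewrite lee_fin//.
by rewrite ler_piMl//; have /andP[] := alpha01 x.
Qed.

(** All sites outside the range of [pos] are merged into the reservoir. The rate of entry at [j]
    sums their contributions as if each were infinitely occupied; the rate of exit from [i] is the
    mass of [p] that leads outside. *)
Definition rate (e : option I * option I) : R :=
  match e with
  | (Some i, Some j) => alpha (pos i) * p (pos j - pos i)
  | (Some i, None) => alpha (pos i) * (1 - \sum_j p (pos j - pos i))
  | (None, Some j) => fine (\esum_(x in outside) (alpha x * p (pos j - x))%:E)
  | (None, None) => 0
  end.

Lemma rate_ge0 e : 0 <= rate e.
Proof.
case: e => -[i|] [j|] //=.
- by rewrite mulr_ge0.
- rewrite mulr_ge0// -lee_fin -esum_outside_to.
  by apply: esum_ge0 => y _; rewrite lee_fin.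
- by apply: fine_ge0; apply: esum_ge0 => x _; rewrite lee_fin mulr_ge0.
Qed.

Lemma sum_rate_from i : \sum_b rate (Some i, b) = alpha (pos i).
Proof.
by rewrite sum_option/= -mulr_sumr -mulrDr subrK mulr1.
Qed.

(** Pairs of outside sites get weight 0: a jump between them leaves the observed coordinates
    unchanged, and their total rate may be infinite. *)
Definition pair_weight (xy : site d * site d) : R :=
  if (vertex xy.1, vertex xy.2) == (None, None) then 0
  else alpha xy.1 * p (xy.2 - xy.1).

Lemma pair_weight_ge0 xy : 0 <= pair_weight xy.
Proof. by rewrite /pair_weight; case: ifP => // _; rewrite mulr_ge0. Qed.

(** [rate] is the image of [pair_weight] under [vertex] on both coordinates, tested against [u]. *)
Lemma esum_pair_weight (u : option I * option I -> R) : (forall e, 0 <= u e) ->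
  (\esum_(xy in [set: site d * site d])
     (pair_weight xy * u (vertex xy.1, vertex xy.2))%:E =
   (\sum_e u e * rate e)%:E)%E.
Proof.
move=> u0.
pose a x y := pair_weight (x, y) * u (vertex x, vertex y).
have a0 x y : 0 <= a x y by rewrite mulr_ge0// pair_weight_ge0.
transitivity (\esum_(x in [set: site d]) \esum_(y in [set: site d]) (a x y)%:E)%E.
  rewrite (@esum_esum _ _ _ _ _ (fun x y => (a x y)%:E)); last first.
    by move=> x y _ _; rewrite lee_fin.
  rewrite (_ : setT `*`` _ = setT); last by apply/seteqP; split.
  by apply: eq_esum => -[x y].
have inE i : (\esum_(y in [set: site d]) (a (pos i) y)%:E =
    (\sum_b u (Some i, b) * rate (Some i, b))%:E)%E.
  rewrite esum_vertex// sum_option/=.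
  rewrite addrC EFinD; congr (_ + _)%E.
    congr (_%:E); apply: eq_bigr => j _.
    by rewrite /a /pair_weight/= !vertex_pos/= mulrC.
  rewrite mulrA EFinM -esum_outside_to -esumZl//; last by rewrite mulr_ge0.
  apply: eq_esum => y yO; rewrite /a /pair_weight/= vertex_pos/= yO.
  by congr (_%:E); ring.
have outE x : outside x -> (\esum_(y in [set: site d]) (a x y)%:E =
    (\sum_j u (None, Some j) * (alpha x * p (pos j - x)))%:E)%E.
  move=> xO; rewrite esum_vertex// [X in (_ + X)%E]esum1 ?adde0.
    congr (_%:E); apply: eq_bigr => j _.
    by rewrite /a /pair_weight/= xO vertex_pos/= mulrC.
  by move=> y yO; rewrite /a /pair_weight/= xO yO/= mul0r.
pose b x := fine (\esum_(y in [set: site d]) (a x y)%:E).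
have bE x : (b x)%:E = (\esum_(y in [set: site d]) (a x y)%:E)%E.
  rewrite /b fineK//; case vx: (vertex x) => [i|]; last by rewrite outE.
  by rewrite (vertex_Some vx) inE.
under eq_esum do rewrite -bE.
have b0 x : 0 <= b x by rewrite -lee_fin bE esum_ge0// => y _; rewrite lee_fin.
rewrite esum_vertex//.
have -> : (\sum_e u e * rate e) = \sum_a \sum_b u (a, b) * rate (a, b).
  by rewrite pair_bigA/=; apply: eq_bigr => -[].
rewrite sum_option/= addrC EFinD; congr (_ + _)%E.
  by congr (_%:E); apply: eq_bigr => i _; apply: EFin_inj; rewrite bE inE.
rewrite sum_option/= mulr0 add0r.
under eq_esum => x xO do rewrite bE outE// -sumEFin.
rewrite esum_sum; last by move=> *; rewrite lee_fin !mulr_ge0.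
rewrite -sumEFin; apply: eq_bigr => j _.
rewrite esumZl//; last by move=> x; rewrite mulr_ge0.
by rewrite EFinM fineK// esum_outside_fin.
Qed.

Definition restrict (eta : config d) : I -> natbar := fun i => eta (pos i).

Lemma eq_vertex i x : (Some i == vertex x) = (pos i == x).
Proof.
apply/eqP/eqP => [/esym/vertex_Some -> //|<-]; by rewrite vertex_pos.
Qed.

Lemma restrict_move x y eta :
  restrict (move x y eta) = transfer (vertex x) (vertex y) (restrict eta).
Proof. by apply/funext => i; rewrite /restrict /transfer /move !eq_vertex. Qed.

Lemma esum_pair_weight_fin :
  (\esum_(xy in [set: site d * site d]) (pair_weight xy)%:E < +oo)%E.
Proof.
have := esum_pair_weight (u := fun=> 1) (fun=> ler01).
by under eq_esum do rewrite mulr1; move=> ->; exact: ltry.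
Qed.

Lemma weighted_sum_pair (u : option I * option I -> R) : nonneg_bounded u ->
  weighted_sum pair_weight (fun xy => u (vertex xy.1, vertex xy.2)) =
  \sum_e rate e * u e.
Proof.
move=> bu; apply: EFin_inj.
rewrite weighted_sumE; [|exact: pair_weight_ge0|exact: esum_pair_weight_fin|]; last first.
  by case: bu => M uM; exists M => xy; exact: uM.
rewrite (esum_pair_weight (u := u)).
  by congr (_%:E); apply: eq_bigr => e _; rewrite mulrC.
by move=> e; exact: nonneg_bounded_ge0.
Qed.

(* Sites outside the range of [pos] emit at most as much as infinitely
   occupied ones, and for a nondecreasing function only their input counts. *)
Lemma zr_generator_le (g : nat -> R) (hg : jump_rate g) (F : (I -> natbar) -> R)
    (eta : config d) : nondecreasing_state F -> nonneg_bounded F ->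
  zr_generator g p alpha (F \o restrict) eta <=
  \sum_e rate e * (departure g e.1 (restrict eta) *
     (F (transfer e.1 e.2 (restrict eta)) - F (restrict eta))).
Proof.
move=> Fmono bF; have [M FM] := bF.
set eta' := restrict eta.
pose gh (x : site d) := extend_rate g (eta x).
have gh01 x : 0 <= gh x <= 1 by exact: extend_rate_itv.
pose A (xy : site d * site d) :=
  gh xy.1 * F (transfer (vertex xy.1) (vertex xy.2) eta').
pose B (xy : site d * site d) := gh xy.1 * F eta'.
have bgh : nonneg_bounded (gh \o (@fst (site d) (site d))).
  by exists 1 => xy; exact: gh01.
have bA : nonneg_bounded A by apply: nonneg_boundedM bgh _; exists M => xy.
have bB : nonneg_bounded B by apply: nonneg_boundedM bgh _; exists M => xy.
have -> : zr_generator g p alpha (F \o restrict) eta =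
    real_sum (fun xy => pair_weight xy * (A xy - B xy)).
  rewrite /zr_generator; congr real_sum; apply/funext => -[x y] /=.
  rewrite restrict_move /pair_weight/= -/eta' /A /B/= -/(gh x).
  case: eqP => [[-> ->]|_]; last by ring.
  rewrite (_ : transfer None None eta' = eta') ?subrr ?mulr0//.
  by apply/funext => i; rewrite /transfer; case: (eta' i) => //= n; rewrite subn0 addn0.
have w0 := pair_weight_ge0; have wfin := esum_pair_weight_fin.
rewrite real_sum_weighted//.
pose u (e : option I * option I) :=
  departure g e.1 eta' * (F (transfer e.1 e.2 eta') - F eta').
have M0 : 0 <= M by have /andP[/le_trans] := FM eta'; exact.
have uM e : - M <= u e <= M.
  have /andP[d0 d1] := departure_itv hg e.1 eta'.
  have /andP[? ?] := FM eta'; have /andP[? ?] := FM (transfer e.1 e.2 eta').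
  rewrite /u; nra.
(* The increments are signed, whereas [weighted_sum] handles nonnegative functions: hence the two
   parts of [u]. *)
pose up e := Num.max (u e) 0; pose un e := Num.max (- u e) 0.
have bup : nonneg_bounded up.
  exists M => e; rewrite /up le_max lexx orbT/= ge_max M0 andbT.
  by have /andP[] := uM e.
have bun : nonneg_bounded un.
  exists M => e; rewrite /un le_max lexx orbT/= ge_max M0 andbT.
  by rewrite lerNl; have /andP[] := uM e.
have uE e : u e = up e - un e.
  by rewrite /up /un; case: (leP (u e) 0) => ?; case: (leP (- u e) 0) => ?; lra.
have bup' : nonneg_bounded (fun xy => up (vertex xy.1, vertex xy.2)).
  by case: bup => N upN; exists N => xy; exact: upN.
have bun' : nonneg_bounded (fun xy => un (vertex xy.1, vertex xy.2)).
  by case: bun => N unN; exists N => xy; exact: unN.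
have -> : \sum_e rate e * (departure g e.1 eta' *
    (F (transfer e.1 e.2 eta') - F eta')) =
    weighted_sum pair_weight (fun xy => up (vertex xy.1, vertex xy.2)) -
    weighted_sum pair_weight (fun xy => un (vertex xy.1, vertex xy.2)).
  rewrite !weighted_sum_pair// -sumrB; apply: eq_bigr => e _.
  by rewrite -mulrBr -uE.
suff : weighted_sum pair_weight A +
    weighted_sum pair_weight (fun xy => un (vertex xy.1, vertex xy.2)) <=
    weighted_sum pair_weight B +
    weighted_sum pair_weight (fun xy => up (vertex xy.1, vertex xy.2)) by lra.
rewrite -!weighted_sumD//.
apply: ler_weighted_sum => //; [exact: nonneg_boundedD..|] => -[x y] /=.
suff : A (x, y) - B (x, y) <= u (vertex x, vertex y) by rewrite uE; lra.
rewrite /A /B /u/= -mulrBr /gh.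
case vx: (vertex x) => [i|] /=; first by rewrite (vertex_Some vx).
rewrite mul1r ler_piMl//; last by have /andP[] := gh01 x.
rewrite subr_ge0; apply: Fmono => i; rewrite /transfer.
by case: (eta' i) => //= n; rewrite subn0 leq_addr.
Qed.

End rates.

(** * Continuity of the network kernel *)

Section continuity.
Context {R : realType} {I : finType}.
Variable g : nat -> R.
Hypothesis hg : jump_rate g.
Variable Q : option I * option I -> R.

Let statespace := prod_topology (fun _ : I => natbar).

Lemma continuous_departure (a : option I) :
  continuous (departure g a : statespace -> R).
Proof.
case: a => [i|]; last first.
  change (continuous (cst 1 : statespace -> R)); exact: cst_continuous.
have cp : continuous (proj i : statespace -> natbar) by exact: proj_continuous.
have ce : continuous (extend_rate g).
  by apply: natbar_continuous; have [_ _ _ _] := hg.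
move=> eta; exact: (continuous_comp (cp eta) (ce _)).
Qed.

Lemma continuous_transfer (a b : option I) :
  continuous (transfer a b : statespace -> statespace).
Proof.
apply: prod_topology_continuous => i.
have cp : continuous (proj i : statespace -> natbar) by exact: proj_continuous.
have co : continuous (omap (fun n => n - (Some i == a) + (Some i == b))%N :
    natbar -> natbar).
  apply: omap_continuous.
  exact: (cvg_comp _ _ (@cvg_subnr (Some i == a)) (@cvg_addnr (Some i == b))).
move=> eta; exact: (continuous_comp (cp eta) (co _)).
Qed.

(** Each iterate must in turn be a legitimate argument of the generator. The departure rates are
    continuous at infinity because [g] tends to 1, the value of [extend_rate g] there. *)
Lemma continuous_network_step (F : statespace -> R) : continuous F ->
  continuous (network_step g Q F : statespace -> R).
Proof.
move=> cF.
have cFt (a b : option I) : continuous (fun eta : statespace => F (transfer a b eta)).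
  move=> eta; exact: (continuous_comp (@continuous_transfer a b eta) (cF _)).
have cterm (e : option I * option I) : continuous (fun eta : statespace =>
    Q e / clock_rate Q * departure g e.1 eta * (F (transfer e.1 e.2 eta) - F eta)).
  have h1 : continuous (fun _ : statespace => Q e / clock_rate Q).
    by move=> x; apply: cst_continuous.
  have h2 : continuous (departure g e.1 : statespace -> R) by exact: continuous_departure.
  have h3 := cFt e.1 e.2.
  move=> eta.
  have h4 := continuousM (continuousM (h1 eta) (h2 eta)) (continuousB (h3 eta) (cF eta)).
  exact h4.
have csum := @continuous_big R _ +%R 0 xpredT (@add_continuous R) statespace
  (index_enum _) _ (fun e _ => cterm e).
move=> eta; exact (continuousD (cF eta) (csum eta)).
Qed.

End continuity.

(** * A hierarchy of differential inequalities *)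

Section discrete_comparison.
Context {R : realType}.
Variables (a : nat -> R -> R) (K l M : R).
Hypothesis K0 : 0 < K.
Hypothesis l0 : 0 <= l.
Hypothesis a0 : forall n (t : R), 0 <= a n t <= M.
Hypothesis astep : forall n e, 0 < e -> exists2 r0 : R, 0 < r0 & forall r t : R,
  0 < r < r0 -> 0 <= t -> a n (t + r) <= a n t + r * (K * (a n.+1 t - a n t) + e).

(* The right-hand side dominates the solution of the differential inequality
   [a_n' <= K (a_(n+1) - a_n)]: both [2^-n e^(-K t/2)] and [2^n e^(K t)] solve
   the corresponding equation, and the latter, with a small coefficient,
   absorbs the unbounded range of [n]. *)
Lemma evolution_bound n0 tau : 0 < tau ->
  (forall n, (n0 <= n)%N -> a n 0 <= l) ->
  a 0%N tau <= l + M * 2 ^+ n0 * expR (- (K * tau / 2)).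
Proof.
move=> tau0 an0; apply/ler_addgt0Pr => e e0.
have M0 : 0 <= M by have /andP[] := a0 0 0; exact: le_trans.
pose C := M * 2 ^+ n0.
have C0 : 0 <= C by rewrite mulr_ge0.
(* At time [tau] the growing solution with coefficient [io] and the accumulated errors [ep] each
   amount to [e / 2], up to a discretization in the favourable direction. *)
pose io := e / 2 * expR (- (K * tau)).
have io0 : 0 < io by rewrite mulr_gt0 ?expR_gt0// divr_gt0.
pose ep := e / (2 * tau).
have ep0 : 0 < ep by rewrite divr_gt0// mulr_gt0.
(* At level [J] the growing solution already exceeds the bound [M], so only levels below [J] are
   stepped, and these finitely many have a common [r0]. *)
have [J MJ] : exists J, M <= io * 2 ^+ J.
  exists (Num.truncn (M / io)).+1.
  rewrite mulrC -ler_pdivrMr//.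
  apply: le_trans (ltW (truncnS_gt _)) _.
  by rewrite -natrX ler_nat ltnW// ltn_expl.
have [r0 r00 stepJ] : exists2 r0 : R, 0 < r0 & forall n (r t : R), (n < J)%N ->
    0 < r < r0 -> 0 <= t -> a n (t + r) <= a n t + r * (K * (a n.+1 t - a n t) + ep).
  elim: J {MJ} => [|J [r0 r00 IH]]; first by exists 1.
  have [r1 r10 Hr1] := astep J ep0.
  exists (Num.min r0 r1) => [|n r t]; first by rewrite lt_min r00.
  rewrite ltnS leq_eqVlt lt_min => /predU1P[->|nJ] /and3P[rp rr0 rr1] t0.
    by apply: Hr1; rewrite ?rp.
  by apply: IH; rewrite ?rp.
pose N := (Num.truncn (tau / (Num.min r0 K^-1))).+1.
have m0 : 0 < Num.min r0 K^-1 by rewrite lt_min r00 invr_gt0.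
have N0 : 0 < N%:R :> R by rewrite ltr0n.
pose r : R := tau / N%:R.
have rp : 0 < r by rewrite divr_gt0.
have : r < Num.min r0 K^-1.
  rewrite /r ltr_pdivrMr// mulrC -ltr_pdivrMr//; exact: truncnS_gt.
rewrite lt_min => /andP[rr0 rK].
have rK1 : r * K < 1 by rewrite -ltr_pdivlMr// mul1r.
have rK0 : 0 < r * K by rewrite mulr_gt0.
have le_sum4 (u x1 x2 x3 x4 : R) : u <= x3 -> 0 <= x1 -> 0 <= x2 -> 0 <= x4 ->
  u <= x1 + x2 + x3 + x4 by lra.
(* Explicit Euler scheme of step [r]: both 2^-n (1 - rK/2)^k and 2^n (1 + rK)^k solve x_n(k+1) = (1
   - rK) x_n(k) + rK x_(n+1)(k) exactly. The choice r < 1/K keeps its coefficients nonnegative. *)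
have main k n : (n <= J)%N -> a n (k%:R * r) <=
    l + C * 2 ^- n * (1 - r * K / 2) ^+ k + io * 2 ^+ n * (1 + r * K) ^+ k +
    ep * r * k%:R.
  elim: k n => [|k IH] n nJ.
    rewrite mul0r !expr0 !mulr1 mulr0 addr0.
    have ion : 0 <= io * 2 ^+ n by rewrite mulr_ge0// ltW.
    have Cn : 0 <= C * 2 ^- n by rewrite mulr_ge0// invr_ge0.
    (* At time 0, levels below [n0] are covered by [M <= C * 2 ^- n], whence the factor [2 ^+ n0] in
       [C]. *)
    have [/an0|nn0] := leqP n0 n; first by lra.
    have : M <= C * 2 ^- n.
      rewrite -ler_pdivrMr ?invr_gt0 ?exprn_gt0// invrK /C ler_wpM2l//.
      by rewrite ler_weXn2l ?ler1n// ltnW.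
    move=> MC; have /andP[_ aM] := a0 n 0.
    by rewrite (le_trans aM)// (le_trans MC)// -addrA ler_wpDl// lerDl.
  have q1 : 0 <= (1 - r * K / 2) ^+ k.+1 by rewrite exprn_ge0//; lra.
  have q2 : 1 <= (1 + r * K) ^+ k.+1 by rewrite exprn_ege1//; lra.
  have C2 : 0 <= C * 2 ^- n * (1 - r * K / 2) ^+ k.+1.
    by rewrite !mulr_ge0// invr_ge0.
  have e2 : 0 <= ep * r * k.+1%:R by apply: mulr_ge0 => //; apply: mulr_ge0; exact: ltW.
  move: nJ; rewrite leq_eqVlt => /predU1P[->|nJ].
    have /andP[_ aM] := a0 J (k.+1%:R * r).
    apply: le_sum4 => //; last by rewrite !mulr_ge0// invr_ge0.
    apply: (le_trans aM); apply: (le_trans MJ).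
    by rewrite ler_peMr// mulr_ge0// ltW.
  rewrite -natr1 mulrDl mul1r.
  have kr0 : 0 <= k%:R * r by rewrite mulr_ge0// ltW.
  have r0r : 0 < r < r0 by rewrite rp.
  apply: (le_trans (stepJ n r (k%:R * r) nJ r0r kr0)).
  have h1 := IH n (ltnW nJ); have h2 := IH n.+1 nJ.
  set x := a n _ in h1 *; set y := a n.+1 _ in h2 *.
  have -> : x + r * (K * (y - x) + ep) = (1 - r * K) * x + r * K * y + ep * r by ring.
  apply: le_trans (lerD (lerD (ler_wpM2l _ h1) (ler_wpM2l _ h2)) (lexx _)) _.
  - lra.
  - exact: ltW.
  rewrite le_eqVlt; apply/orP; left; apply/eqP.
  rewrite !exprSr; field.
  by rewrite expf_neq0.
have := main N 0%N (leq0n _).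
have -> : N%:R * r = tau by rewrite /r mulrC divfK// gt_eqF.
have le_expr (x : R) : 0 <= 1 + x -> (1 + x) ^+ N <= expR (N%:R * x).
  move=> x0; rewrite mulrC expRM_natr lerXn2r ?nnegrE ?expR_ge0//.
  exact: expR_ge1Dx.
have h1 : (1 - r * K / 2) ^+ N <= expR (- (K * tau / 2)).
  have -> : - (K * tau / 2) = N%:R * (- (r * K / 2)).
    by rewrite /r; field; rewrite gt_eqF.
  by apply: le_expr; lra.
have h2 : (1 + r * K) ^+ N <= expR (K * tau).
  have -> : K * tau = N%:R * (r * K) by rewrite /r; field; rewrite gt_eqF.
  by apply: le_expr; lra.
rewrite !expr0 invr1 !mulr1 => h.
have h3 : ep * r * N%:R = e / 2.
  by rewrite /ep /r; field; rewrite !gt_eqF.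
have h4 : io * expR (K * tau) = e / 2.
  by rewrite /io -mulrA -expRD addNr expR0 mulr1.
have := ler_wpM2l C0 h1; have := ler_wpM2l (ltW io0) h2.
rewrite h4 -/C; move: h; rewrite h3; lra.
Qed.

End discrete_comparison.

Lemma bounded_measurable_integrable (R : realType) (d : measure_display)
    (T : measurableType d) (P : {measure set T -> \bar R}) (F : T -> R) (M : R) :
  P setT = 1%E -> measurable_fun setT F -> (forall x, `|F x| <= M) ->
  P.-integrable setT (EFin \o F).
Proof.
move=> P1 mF FM; apply: measurable_bounded_integrable => //.
  by rewrite P1 ltry.
exists M; split; first exact: num_real.
by move=> y My x _ /=; rewrite (le_trans (FM x))// ltW.
Qed.

(** * Feller semigroups acting on bounded functions *)

Section feller.
Context {R : realType} {d : nat}.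

Lemma continuous_config_measurable (F : config d -> R) :
  continuous F -> measurable_fun setT F.
Proof.
move=> /continuousP cF; apply: (measurability _ (RGenOpens.measurableE R)).
move=> _ [_ [a [b ->] <-]]; rewrite setTI; apply: sub_sigma_algebra.
exact/cF/interval_open.
Qed.

Variable S : R -> R.-pker (config d) ~> (config d).
Hypothesis hS : feller_semigroup S.

Lemma chapman_kolmogorov s t eta (f : config d -> \bar R) : 0 <= s -> 0 <= t ->
  (forall zeta, 0 <= f zeta)%E -> measurable_fun setT f ->
  (\int[S (s + t) eta]_zeta f zeta =
   \int[S s eta]_xi \int[S t xi]_zeta f zeta)%E.
Proof.
move=> s0 t0 f0 mf; have [_ SS _ _] := hS.
rewrite -(integral_kcomp (S s) (kernel.kernel_snd (S t)) eta f0 mf).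
apply: eq_measure_integral => A mA _; exact: SS.
Qed.

Lemma transition_op_itv t (F : config d -> R) M eta : measurable_fun setT F ->
  (forall eta, 0 <= F eta <= M) -> 0 <= transition_op S t F eta <= M.
Proof.
move=> mF FM.
have F0 zeta : 0 <= F zeta by have /andP[] := FM zeta.
have FleM zeta : F zeta <= M by have /andP[] := FM zeta.
rewrite /transition_op Rintegral_ge0//=.
apply: (@le_trans _ _ (\int[S t eta]_zeta M)); last first.
  by rewrite Rintegral_cst//= prob_kernel/= mulr1.
apply: le_Rintegral => //.
- by apply: (bounded_measurable_integrable (M := M)) => [||zeta];
  rewrite ?prob_kernel ?ger0_norm.
- by apply: (bounded_measurable_integrable (M := `|M|)); rewrite ?prob_kernel.
Qed.

Lemma transition_opD t r (F : config d -> R) M eta : 0 <= t -> 0 <= r ->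
  measurable_fun setT F -> (forall eta, 0 <= F eta <= M) ->
  transition_op S (t + r) F eta = transition_op S t (transition_op S r F) eta.
Proof.
move=> t0 r0 mF FM.
have F0 zeta : 0 <= F zeta by have /andP[] := FM zeta.
have FleM zeta : F zeta <= M by have /andP[] := FM zeta.
rewrite /transition_op /Rintegral chapman_kolmogorov//; last exact/measurable_EFinP.
congr fine; apply: eq_integral => xi _; rewrite fineK//.
apply: integrable_fin_num => //.
by apply: (bounded_measurable_integrable (M := M)) => [||zeta];
  rewrite ?prob_kernel ?ger0_norm.
Qed.

End feller.

(** * The differential inequality for the zero-range semigroup *)

Section comparison.
Context {R : realType} {d : nat} {I : finType}.
Variable pos : I -> site d.
Hypothesis pos_inj : injective pos.
Variables p alpha : site d -> R.
Hypothesis hp : jump_law p.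
Hypothesis alpha01 : forall x, 0 <= alpha x <= 1.
Variable g : nat -> R.
Hypothesis hg : jump_rate g.
Variable S : R -> R.-pker (config d) ~> (config d).
Hypothesis hS : feller_semigroup S.
Hypothesis hgen : forall f : config d -> R, continuous f -> local_fun f ->
  in_generator S f (zr_generator g p alpha f).

Local Notation res := (restrict pos).
Local Notation Q := (rate pos p alpha).
Local Notation statespace := (prod_topology (fun _ : I => natbar)).

Let Q0 e : 0 <= Q e.
Proof. exact: rate_ge0. Qed.

Lemma continuous_restrict : continuous (res : config d -> statespace).
Proof.
apply: prod_topology_continuous => i; exact: (@proj_continuous _ (fun=> natbar) (pos i)).
Qed.

Lemma continuous_comp_restrict (F : statespace -> R) : continuous F ->
  continuous (F \o res : config d -> R).
Proof.
move=> cF eta; apply: (@continuous_comp (config d) statespace R).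
  exact: continuous_restrict.
exact: cF.
Qed.

Lemma local_comp_restrict (F : (I -> natbar) -> R) : local_fun (F \o res).
Proof.
exists [seq pos i | i : I] => eta zeta ez /=; congr F; apply/funext => i.
by apply: ez; apply: map_f; rewrite mem_enum.
Qed.

Lemma transition_op0 (F : config d -> R) eta : measurable_fun setT F ->
  transition_op S 0 F eta = F eta.
Proof.
move=> mF; have [S0 _ _ _] := hS.
rewrite /transition_op /Rintegral (@eq_measure_integral _ _ _ _ \d_eta); last first.
  by move=> A mA _; exact: S0.
by rewrite integral_dirac//; [rewrite diracT mul1e|exact/measurable_EFinP].
Qed.

(** Uniform convergence gives one [r0] for all [eta], as needed to integrate the bound against
    [S t]. *)
Lemma in_generator_unif (f Lf : config d -> R) (e : R) : in_generator S f Lf -> 0 < e ->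
  exists2 r0 : R, 0 < r0 & forall (r : R) eta, 0 < r < r0 ->
    transition_op S r f eta <= f eta + r * (Lf eta + e).
Proof.
move=> [_ genf] e0.
have nP : nbhs (Lf : {uniform (config d) -> R}) [set h | forall y, `|Lf y - h y| < e].
  apply/uniform_nbhs; exists [set xy : R * R | ball xy.1 e xy.2]; split.
    exact: (entourage_ball _ (PosNum e0)).
  by move=> h /= H y; exact: H.
have [r0 /= r00 Hr] := genf _ nP.
exists r0 => // r eta /andP[rp rr0].
have := Hr r; rewrite /= sub0r normrN gtr0_norm// => /(_ rr0 rp eta).
rewrite distrC => /(le_lt_trans (ler_norm _)).
rewrite ltrBlDr mulrC ltr_pdivrMr// => /ltW; lra.
Qed.

Lemma network_step_rate (F : (I -> natbar) -> R) eta :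
  clock_rate Q * (network_step g Q F eta - F eta) =
  \sum_e Q e * (departure g e.1 eta * (F (transfer e.1 e.2 eta) - F eta)).
Proof.
have K0 := clock_rate_gt0 Q0.
rewrite /network_step addrAC subrr add0r mulr_sumr; apply: eq_bigr => e _.
by field; rewrite gt_eqF.
Qed.

(** By the semigroup property the expansion over the short time [r] is done inside [S t], where L F
    <= K (T F - F) holds pointwise; hence [r0] does not depend on [t]. *)
Lemma transition_op_step (F : statespace -> R) (M : R) eta (e : R) : continuous F ->
  nondecreasing_state F -> (forall xi, 0 <= F xi <= M) -> 0 < e ->
  exists2 r0 : R, 0 < r0 & forall r t : R, 0 < r < r0 -> 0 <= t ->
    transition_op S (t + r) (F \o res) eta <=
    transition_op S t (F \o res) eta + r * (clock_rate Q *
      (transition_op S t (network_step g Q F \o res) eta -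
       transition_op S t (F \o res) eta) + e).
Proof.
move=> cF Fmono FM e0.
have [r0 r00 Hr] := in_generator_unif
  (hgen (continuous_comp_restrict cF) (local_comp_restrict F)) e0.
exists r0 => // r t /[dup] rr /andP[rp _] t0.
set G := network_step g Q F.
have GM xi : 0 <= G xi <= M by exact: network_step_itv.
have cG : continuous (G : statespace -> R) by exact: continuous_network_step.
have mF := continuous_config_measurable (continuous_comp_restrict cF).
have mG := continuous_config_measurable (continuous_comp_restrict cG).
have bF : exists M, forall xi, 0 <= F xi <= M by exists M.
have FresM zeta : 0 <= (F \o res) zeta <= M by exact: FM.
rewrite (transition_opD hS eta t0 (ltW rp) mF FresM).
have [_ _ Scont _] := hS.
have cSF := Scont r _ (ltW rp) (continuous_comp_restrict cF).
have mSF := continuous_config_measurable cSF.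
have SFM zeta : 0 <= transition_op S r (F \o res) zeta <= M.
  exact: transition_op_itv.
have S1 : S t eta setT = 1%E by exact: prob_kernel.
have intb (H : config d -> R) : measurable_fun setT H ->
    (forall zeta, 0 <= H zeta <= M) -> (S t eta).-integrable setT (EFin \o H).
  move=> mH HM; apply: (bounded_measurable_integrable (M := M)) => // zeta.
  by have /andP[H0 H1] := HM zeta; rewrite ger0_norm.
have iF := intb _ mF FresM; have iG := intb _ mG (fun zeta => GM _).
have ie : (S t eta).-integrable setT (EFin \o (fun _ : config d => r * e)).
  by apply: (bounded_measurable_integrable (M := `|r * e|)).
set K := clock_rate Q.
have iKF : (S t eta).-integrable setT (EFin \o (fun zeta => (1 - r * K) * (F \o res) zeta)).
  exact: (integrableZl measurableT _ iF).
have iKG : (S t eta).-integrable setT (EFin \o (fun zeta => (r * K) * (G \o res) zeta)).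
  exact: (integrableZl measurableT _ iG).
have iFG : (S t eta).-integrable setT (EFin \o (fun zeta =>
    (1 - r * K) * (F \o res) zeta + (r * K) * (G \o res) zeta)).
  exact: (integrableD measurableT iKF iKG).
have iFGe : (S t eta).-integrable setT (EFin \o (fun zeta =>
    (1 - r * K) * (F \o res) zeta + (r * K) * (G \o res) zeta + r * e)).
  exact: (integrableD measurableT iFG ie).
have -> : transition_op S t (F \o res) eta + r * (K *
      (transition_op S t (G \o res) eta - transition_op S t (F \o res) eta) + e) =
    \int[S t eta]_zeta ((1 - r * K) * (F \o res) zeta + (r * K) * (G \o res) zeta + r * e).
  rewrite (RintegralD measurableT iFG ie) (RintegralD measurableT iKF iKG).
  rewrite (RintegralZl _ measurableT iF) (RintegralZl _ measurableT iG).
  rewrite Rintegral_cst//= S1/= mulr1 /transition_op; ring.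
apply: le_Rintegral => //; first exact: intb.
move=> zeta _ /=; apply: (le_trans (Hr r zeta rr)).
have := zr_generator_le pos_inj hp alpha01 hg zeta Fmono bF.
rewrite -network_step_rate -/G -/K /=.
move: (zr_generator _ _ _ _ _) => L LK.
have : r * (L + e) <= r * (K * (G (res zeta) - F (res zeta)) + e).
  by rewrite ler_wpM2l ?lerD2r// ltW.
lra.
Qed.

Lemma transition_op_limsup (f : statespace -> R) (M l : R) eta n0 : continuous f ->
  nondecreasing_state f -> (forall xi, 0 <= f xi <= M) -> 0 <= l ->
  (forall n, (n0 <= n)%N -> evolution g Q f n (res eta) <= l) ->
  forall e : R, 0 < e -> \forall t \near +oo, transition_op S t (f \o res) eta <= l + e.
Proof.
move=> cf fmono fM l0 fl e e0.
have K0 := clock_rate_gt0 Q0.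
pose F n : statespace -> R := evolution g Q f n.
have cF n : continuous (F n : statespace -> R).
  elim: n => [|n IH]; first exact: cf.
  exact (@continuous_network_step _ _ _ hg Q (F n) IH).
have FM n xi : 0 <= F n xi <= M by exact: (evolution_itv hg Q0 fM).
have Fmono n : nondecreasing_state (F n) by exact: (nondecreasing_evolution hg Q0 fmono).
have mF n := continuous_config_measurable (continuous_comp_restrict (cF n)).
pose a n t := transition_op S t (F n \o res) eta.
have a0 n t : 0 <= a n t <= M
  by apply: transition_op_itv => // zeta; exact: FM.
have astep n (e1 : R) : 0 < e1 -> exists2 r0 : R, 0 < r0 & forall r t : R,
    0 < r < r0 -> 0 <= t ->
    a n (t + r) <= a n t + r * (clock_rate Q * (a n.+1 t - a n t) + e1).
  by move=> e10; exact: (transition_op_step eta (cF n) (Fmono n) (FM n) e10).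
have M0 : 0 <= M by have /andP[] := a0 0%N 0; exact: le_trans.
have an0 n : (n0 <= n)%N -> a n 0 <= l by move=> /fl; rewrite /a transition_op0.
pose C := M * 2 ^+ n0.
have C0 : 0 <= C by rewrite mulr_ge0.
(* [expR (- x) <= 1 / x] *)
exists (2 * (C + 1) / (clock_rate Q * e)); split; first exact: num_real.
move=> t Ht.
have t0 : 0 < t.
  apply: le_lt_trans Ht; apply: divr_ge0; apply: mulr_ge0 => //.
  - exact: addr_ge0.
  - exact: ltW.
  - exact: ltW.
apply: (le_trans (evolution_bound K0 l0 a0 astep t0 an0)).
rewrite lerD2l -/C.
set x := clock_rate Q * t / 2.
have x0 : 0 < x by rewrite divr_gt0// mulr_gt0.
have Cx : C <= e * x.
  move: Ht; rewrite ltr_pdivrMr ?mulr_gt0// /x => Ht.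
  by apply/ltW; lra.
rewrite expRN ler_pdivrMr ?expR_gt0//; apply: (le_trans Cx).
rewrite ler_wpM2l ?ltW//.
by have := expR_ge1Dx x; lra.
Qed.

End comparison.

(** * The reversed walk and fugacity profiles *)

Section reversed_walk.
Context {R : realType} {d : nat}.
Variable p : site d -> R.
Hypothesis hp : jump_law p.

Let p0 z : 0 <= p z. Proof. by have [] := hp. Qed.

(** The mean of [u] after one step of the reversed walk, which goes from [x] to [y] with probability
    [p (x - y)]. *)
Definition backward_mean (u : site d -> R) (x : site d) : R :=
  weighted_sum (fun y => p (x - y)) u.

Lemma backward_weight_ge0 x y : 0 <= p (x - y).
Proof. by []. Qed.

Lemma backward_weight_fin x : (\esum_(y in [set: site d]) (p (x - y))%:E < +oo)%E.
Proof. by rewrite esum_jump_law_from// ltry. Qed.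

Lemma backward_mean_cst (k : R) x : 0 <= k -> backward_mean (fun=> k) x = k.
Proof.
move=> k0; apply: EFin_inj; rewrite weighted_sumE.
- under eq_esum do rewrite mulrC.
  by rewrite esumZl// esum_jump_law_from// mule1.
- by [].
- exact: backward_weight_fin.
- by exists k => y; rewrite k0 lexx.
Qed.

Lemma le_backward_mean (u v : site d -> R) x : nonneg_bounded u -> nonneg_bounded v ->
  (forall y, 0 < p (x - y) -> u y <= v y) -> backward_mean u x <= backward_mean v x.
Proof. by apply: ler_weighted_sum_supp => //; exact: backward_weight_fin. Qed.

Variable D : pred (site d).

(** The probability that the reversed walk from [x] stays in [D] at times 0 to [n], given by its
    recursion without reference to a walk; [survival_le] makes the link. *)
Fixpoint survival n x : R :=
  if n is m.+1 then (D x)%:R * backward_mean (survival m) x else (D x)%:R.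

Lemma survival_itv n x : 0 <= survival n x <= 1.
Proof.
have D01 y : 0 <= ((D y)%:R : R) <= 1 by case: (D y); rewrite ?ler01 lexx.
elim: n x => [|n IH] x; first exact: D01.
have bs : nonneg_bounded (survival n) by exists 1.
have b1 : nonneg_bounded (fun _ : site d => 1 : R) by exists 1 => y; rewrite ler01 lexx.
have s0 : 0 <= backward_mean (survival n) x.
  by apply: weighted_sum_ge0 => //; exact: backward_weight_fin.
have s1 : backward_mean (survival n) x <= 1.
  rewrite -[leRHS](backward_mean_cst x ler01).
  by apply: le_backward_mean => // y _; have /andP[] := IH y.
have /andP[D0 D1] := D01 x.
by rewrite /= mulr_ge0//= mulr_ile1.
Qed.

Context {dW : measure_display} {W : measurableType dW} (Pr : probability W R).
Variables (x : site d) (X : nat -> W -> site d).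
Hypothesis hX : random_walk (fun z => p (- z)) x Pr X.

Let path_then m n (y : nat -> site d) : set W :=
  [set w | forall i, ((i <= m)%N -> X i w = y i) /\
                     ((m <= i <= m + n)%N -> D (X i w))].

Lemma measurable_site_pred i (B : set (site d)) : measurable [set w | B (X i w)].
Proof.
rewrite (_ : [set w | _] = \bigcup_(k : nat)
    (if @unpickle (site d) k is Some z then [set w | X i w = z /\ B z] else set0)).
  apply: bigcupT_measurable => k; case: unpickle => [z|]; last exact: measurable0.
  have [Bz|nBz] := pselect (B z).
    rewrite (_ : [set _ | _] = [set w | X i w = z]); first by have [mX _] := hX.
    by apply/seteqP; split => w /=; [case|].
  rewrite (_ : [set _ | _] = set0); first exact: measurable0.
  by apply/seteqP; split => w //= -[].
apply/seteqP; split => w /= => [BX|[k _]].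
  by exists (pickle (X i w)) => //; rewrite pickleK.
by case: unpickle => // z [->].
Qed.

Let measurable_path_then m n y : measurable (path_then m n y).
Proof.
rewrite (_ : path_then m n y = \bigcap_(i : nat)
   [set w | [set z | ((i <= m)%N -> z = y i) /\ ((m <= i <= m + n)%N -> D z)] (X i w)]).
  by apply: bigcapT_measurable => i; exact: measurable_site_pred.
by apply/seteqP; split => w /= H i; [move=> _; exact: H|exact: (H i I)].
Qed.

Let path m (y : nat -> site d) : set W := [set w | forall i, (i <= m)%N -> X i w = y i].

Let path_extend (y : nat -> site d) m z i := if (i <= m)%N then y i else z.

Let prob_path m y : R := (y 0%N == x)%:R * \prod_(i < m) p (y i - y i.+1).

Let prob_pathE m y : Pr (path m y) = (prob_path m y)%:E.
Proof.
have [_ ->] := hX; congr (_ * _)%:E; apply: eq_bigr => i _.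
by rewrite opprB.
Qed.

Let prob_path_ge0 m y : 0 <= prob_path m y.
Proof. by rewrite mulr_ge0// prodr_ge0. Qed.

Let prob_path_extend m y z :
  prob_path m.+1 (path_extend y m z) = prob_path m y * p (y m - z).
Proof.
rewrite /prob_path big_ord_recr/= mulrA; congr (_ * _ * _).
  apply: eq_bigr => i _; rewrite /path_extend.
  by rewrite (ltnW (ltn_ord i)) ltn_ord.
by rewrite /path_extend leqnn ltnn.
Qed.

(** [random_walk] prescribes the probabilities of finite paths, so the induction on [n] runs over
    all pasts [y] up to time [m]. Different next sites [z] give disjoint events, and finite sets of
    them bound the probability from below. *)
Let survival_path n m y :
  ((prob_path m y * survival n (y m))%:E <= Pr (path_then m n y))%E.
Proof.
elim: n m y => [|n IH] m y.
  have [Dy|nDy] := boolP (D (y m)); last by rewrite /= (negbTE nDy) mulr0.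
  rewrite /= Dy mulr1 -prob_pathE le_eqVlt; apply/orP; left; apply/eqP.
  congr (Pr _); apply/seteqP; split => w /= H i; last by have [] := H i.
  split; first exact: H.
  by rewrite addn0 -eqn_leq => /eqP <-; rewrite H.
have [Dy|nDy] := boolP (D (y m)); last by rewrite /= (negbTE nDy) mul0r mulr0.
rewrite /= Dy mul1r EFinM.
have bs : nonneg_bounded (survival n) by exists 1; exact: survival_itv.
rewrite /backward_mean weighted_sumE//; last exact: backward_weight_fin.
rewrite -esumZl//; last by move=> z; rewrite mulr_ge0//; have /andP[] := survival_itv n z.
apply: ge_ereal_sup => _ [F [finF _] <-].
apply: (@le_trans _ _ (\sum_(z \in F) Pr (path_then m.+1 n (path_extend y m z)))%E).
  apply: lee_fsum => // z _; rewrite mulrA -prob_path_extend.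
  have e : path_extend y m z m.+1 = z by rewrite /path_extend ltnn.
  by have := IH m.+1 (path_extend y m z); rewrite e.
rewrite -measure_fin_bigcup//.
- apply: le_measure.
  + rewrite inE; apply: fin_bigcup_measurable => //.
  + by rewrite inE.
  move=> w [z Fz] /= H i; split => [im|/andP[mi imn]].
    by have [/(_ (leqW im)) -> _] := H i; rewrite /path_extend im.
  have [_ H2] := H i; move: mi; rewrite leq_eqVlt => /predU1P[mi|mi].
    have [/(_ (leqW (leqnn m))) + _] := H m; rewrite mi => ->.
    by rewrite -mi /path_extend leqnn.
  by apply: H2; rewrite mi addSnnS.
- move=> z1 z2 _ _ [w [/= H1 H2]].
  have [/(_ (leqnn _)) e1 _] := H1 m.+1; have [/(_ (leqnn _)) e2 _] := H2 m.+1.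
  by move: e1 e2; rewrite /path_extend ltnn => <- <-.
Qed.

Lemma survival_le n :
  ((survival n x)%:E <= Pr [set w | forall i, (i <= n)%N -> D (X i w)])%E.
Proof.
have := survival_path n 0 (fun=> x); rewrite /prob_path eqxx big_ord0 !mul1r.
move/le_trans; apply; apply: le_measure; rewrite ?inE//.
- rewrite (_ : [set w | _] = \bigcap_(i : nat)
     [set w | [set z | (i <= n)%N -> D z] (X i w)]).
    by apply: bigcapT_measurable => i; exact: measurable_site_pred.
  by apply/seteqP; split => w /= H i; [move=> _; exact: H|exact: (H i I)].
- by move=> w /= H i ilen; have [_] := H i; apply.
Qed.

Hypothesis notin : {ae Pr, forall w, exists i, ~~ D (X i w)}.

Lemma survival_cvg0 : (fun n => survival n x) @ \oo --> 0.
Proof.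
pose F n := [set w | forall i, (i <= n)%N -> D (X i w)].
have mF n : measurable (F n).
  rewrite (_ : F n = \bigcap_(i : nat)
     [set w | [set z | (i <= n)%N -> D z] (X i w)]).
    by apply: bigcapT_measurable => i; exact: measurable_site_pred.
  by apply/seteqP; split => w /= H i; [move=> _; exact: H|exact: (H i I)].
have mIF : measurable (\bigcap_n F n) by exact: bigcapT_measurable.
have IF0 : Pr (\bigcap_n F n) = 0%E.
  apply/(measure_negligible mIF).
  apply: negligibleS notin => w /= H [i /negP]; apply.
  exact: (H i I i (leqnn i)).
have Fcvg : (Pr \o F) @ \oo --> Pr (\bigcap_n F n).
  apply: nonincreasing_cvg_mu => //.
    by rewrite -ge0_fin_numE// fin_num_measure.
  by move=> m n mn; apply/subsetPset => w /= H i im; apply: H; exact: leq_trans im mn.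
rewrite IF0 in Fcvg.
have fcvg : (fun n => fine (Pr (F n))) @ \oo --> 0 by exact: (fine_cvg Fcvg).
apply: (squeeze_cvgr _ (cvg_cst 0) fcvg); apply: nearW => n.
have /andP[-> _] := survival_itv n x; rewrite /= -lee_fin fineK ?fin_num_measure//.
exact: survival_le.
Qed.

End reversed_walk.

(** * Superharmonic fugacity profiles *)

Section fugacity_profile.
Context {R : realType} {d : nat}.
Variable p : site d -> R.
Hypothesis hp : jump_law p.
Variables (c : R) (alpha : site d -> R).
Hypothesis c01 : 0 < c < 1.
Hypothesis halpha : environment c alpha.

(* Value iteration for [lambda = min (alpha, backward mean of lambda)] on the
   finite set [L], every other site being a source of intensity [alpha]. *)
Fixpoint profile (L : seq (site d)) k x : R :=
  if k is m.+1 then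
    if x \in L then Num.min (alpha x) (backward_mean p (profile L m) x) else alpha x
  else alpha x.

Let c0 : 0 <= c. Proof. by have /andP[/ltW] := c01. Qed.

Lemma profile_itv L k x : c <= profile L k x <= alpha x.
Proof.
elim: k x => [|k IH] x /=; have /andP[cx x1] := halpha x.
  by rewrite lexx (ltW cx).
case: ifP => _; last by rewrite lexx (ltW cx).
rewrite ge_min lexx/= andbT le_min (ltW cx)/=.
rewrite -[leLHS](backward_mean_cst hp x c0); apply: le_backward_mean => //.
- by exists c => y; rewrite c0 lexx.
- exists 1 => y; have /andP[h1 h2] := IH y; have /andP[_ h3] := halpha y.
  by rewrite (le_trans c0)//= (le_trans h2).
- by move=> y _; have /andP[] := IH y.
Qed.

Lemma profile_itv01 L k x : 0 <= profile L k x <= 1.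
Proof.
have /andP[h1 h2] := profile_itv L k x; have /andP[_ h3] := halpha x.
by rewrite (le_trans c0)//= (le_trans h2).
Qed.

Let profile_bounded L k : nonneg_bounded (profile L k).
Proof. by exists 1; exact: profile_itv01. Qed.

Lemma profile_decr L k x : profile L k.+1 x <= profile L k x.
Proof.
elim: k x => [|k IH] x; first by have /andP[] := profile_itv L 1 x.
rewrite [leLHS]/= [leRHS]/=; case: ifP => // _.
rewrite le_min ge_min lexx/= ge_min; apply/orP; right.
exact: (le_backward_mean hp (profile_bounded L k.+1) (profile_bounded L k)).
Qed.

(** The iterates decrease, so the backward mean of iterate k, which is the new value, dominates that
    of iterate k+1. A finite iterate is thus already superharmonic, without passing to a limit in
    [k]. *)
Lemma profile_superharmonic L k x : profile L k x < alpha x ->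
  x \in L /\ backward_mean p (profile L k) x <= profile L k x.
Proof.
case: k => [|k]; first by rewrite ltxx.
have le_k : backward_mean p (profile L k.+1) x <= backward_mean p (profile L k) x.
  by apply: le_backward_mean => // y _; exact: profile_decr.
rewrite [profile L k.+1 x]/=; case: ifP => [xL|]; last by rewrite ltxx.
rewrite gt_min ltxx/= => lt_x; split=> //.
by rewrite le_min le_k (le_trans le_k (ltW lt_x)).
Qed.

(** Unrolling the recursion along the reversed walk: stopping where [alpha < c + e] costs at most
    [c + e], and not meeting such a site within [k] steps costs at most 1. As [p] may have infinite
    support, a finite [L] loses a little mass, which [delta] absorbs. *)
Lemma profile_survival (e : R) k x (delta : R) : 0 < e -> 0 < delta ->
  exists L0 : seq (site d), forall L : seq (site d), {subset L0 <= L} ->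
  profile L k x <=
    c + e + survival p (fun y => c + e <= alpha y) k x + delta.
Proof.
move=> e0; set D := (fun y => c + e <= alpha y).
elim: k x delta => [|k IH] x delta delta0.
  exists [::] => L _ /=; have /andP[_ x1] := halpha x.
  have c0' := c0; rewrite /D.
  by case: (leP (c + e) (alpha x)) => ?; rewrite ?mulr1n ?mulr0n; lra.
have [Dx|nDx] := boolP (D x); last first.
  exists [::] => L _; have /andP[_ le_x] := profile_itv L k.+1 x.
  rewrite /= (negbTE nDx) mul0r addr0; apply: (le_trans le_x).
  by move: nDx; rewrite -ltNge => /ltW ?; lra.
have d2 : 0 < delta / 2 by rewrite divr_gt0.
have [F [uF tailF]] := weighted_tail (w := fun y => p (x - y))
  (backward_weight_ge0 hp x) (backward_weight_fin hp x) d2.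
have [L0 HL0] : exists L0 : seq (site d), forall L, {subset L0 <= L} ->
    forall y : site d, y \in F -> profile L k y <= c + e + survival p D k y + delta / 2.
  elim: F {uF tailF} => [|y F [L1 HL1]]; first by exists [::].
  have [L2 HL2] := IH y _ d2; exists (L1 ++ L2) => L L12 z.
  rewrite in_cons => /predU1P[->|zF].
    by apply: HL2 => u uL; apply: L12; rewrite mem_cat uL orbT.
  by apply: HL1 => // u uL; apply: L12; rewrite mem_cat uL.
exists (x :: L0) => L xL.
have xinL : x \in L by apply: xL; rewrite mem_head.
rewrite /= xinL Dx mul1r ge_min; apply/orP; right.
apply: (le_trans (tailF _ 1 ler01 (profile_itv01 L k))).
rewrite mul1r -lerBrDr.
have bsum : nonneg_bounded (fun y => c + e + delta / 2 + survival p D k y).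
  exists (c + e + delta / 2 + 1) => y; have := survival_itv hp D k y.
  move: c0 e0 d2; lra.
apply: (@le_trans _ _ (backward_mean p (fun y => c + e + delta / 2 + survival p D k y) x)).
  apply: le_trans (weighted_sum_ge_seq (w := fun y => p (x - y)) _ _ uF bsum).
  - rewrite big_seq [leRHS]big_seq; apply: ler_sum => y yF.
    apply: ler_wpM2l; first exact: backward_weight_ge0.
    by apply: (le_trans (HL0 L _ y yF)); [move=> z zL; apply: xL; rewrite in_cons zL orbT|lra].
  - exact: backward_weight_ge0.
  - exact: backward_weight_fin.
have k0 : 0 <= c + e + delta / 2 by move: c0 e0 d2; lra.
have -> : backward_mean p (fun y => c + e + delta / 2 + survival p D k y) x =
    c + e + delta / 2 + backward_mean p (survival p D k) x; last by lra.
rewrite -[in RHS](backward_mean_cst hp x k0); apply: weighted_sumD.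
- exact: backward_weight_ge0.
- exact: backward_weight_fin.
- by exists (c + e + delta / 2) => y; move: c0 e0 d2; lra.
- by exists 1 => y; exact: survival_itv.
Qed.

Hypothesis survival0 : forall (e : R) x, 0 < e ->
  (fun n => survival p (fun y => c + e <= alpha y) n x) @ \oo --> 0.

Lemma exists_superharmonic (s : seq (site d)) (e : R) : 0 < e ->
  exists (lam : site d -> R) (L : seq (site d)),
  [/\ forall x, c <= lam x <= alpha x,
      forall x, lam x < alpha x -> x \in L,
      forall x, lam x < alpha x -> backward_mean p lam x <= lam x &
      forall x, x \in s -> lam x <= c + e].
Proof.
(* One third each for the threshold [c + e / 3], the survival after [k] steps and the mass lost
   outside [L]; [k] is fixed before [L]. *)
move=> e0; have e3 : 0 < e / 3 by rewrite divr_gt0.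
set D := fun y => c + e / 3 <= alpha y.
have [k Hk] : exists k, forall x, x \in s -> survival p D k x <= e / 3.
  suff [k Hk] : exists k, forall n, (k <= n)%N ->
      forall x, x \in s -> survival p D n x <= e / 3 by exists k; exact: Hk.
  elim: s => [|x s [k Hk]]; first by exists 0%N.
  have [k' _ Hk'] : \forall n \near \oo, survival p D n x < e / 3.
    exact: cvgr_lt (survival0 x e3) _ e3.
  exists (maxn k k') => n; rewrite geq_max => /andP[kn k'n] y.
  by rewrite in_cons => /predU1P[->|/(Hk n kn)//]; apply/ltW/Hk'.
have [L HL] : exists L0 : seq (site d), forall L, {subset L0 <= L} ->
    forall x : site d, x \in s -> profile L k x <= c + e / 3 + survival p D k x + e / 3.
  elim: s {Hk} => [|x s [L1 HL1]]; first by exists [::].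
  have [L2 HL2] := profile_survival k x e3 e3; exists (L1 ++ L2) => L L12 z.
  rewrite in_cons => /predU1P[->|zs].
    by apply: HL2 => u uL; apply: L12; rewrite mem_cat uL orbT.
  by apply: HL1 => // u uL; apply: L12; rewrite mem_cat uL.
exists (profile L k), L; split => [x|x|x|x xs].
- exact: profile_itv.
- by case/profile_superharmonic.
- by case/profile_superharmonic.
- have := HL L (fun _ => id) x xs; have := Hk x xs; lra.
Qed.

(** On the whole lattice [alpha] may approach [c]; on a finite set there is room for a profile
    strictly between them. *)
Lemma environment_gap (s : seq (site d)) :
  exists2 e : R, 0 < e & forall x, x \in s -> c + e < alpha x.
Proof.
elim: s => [|x s [e e0 He]]; first by exists 1.
have cx : 0 < (alpha x - c) / 2 by rewrite divr_gt0// subr_gt0; have /andP[] := halpha x.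
exists (Num.min e ((alpha x - c) / 2)) => [|y]; first by rewrite lt_min e0.
rewrite in_cons => /predU1P[->|/He].
  have : Num.min e ((alpha x - c) / 2) <= (alpha x - c) / 2 by rewrite ge_min lexx orbT.
  lra.
by apply: le_lt_trans; rewrite lerD2l ge_min lexx.
Qed.

(* A nonempty set of sites without incoming jumps from its complement would
   confine the reversed walk. *)
Lemma rate_connected (I : finType) (pos : I -> site d) : injective pos ->
  forall C : pred I, (forall j, C j -> forall a,
    0 < rate pos p alpha (a, Some j) -> exists2 i, a = Some i & C i) ->
  forall i, ~~ C i.
Proof.
move=> pos_inj C HC i0; apply/negP => Ci0.
have [p0 _] := hp.
have alpha0 x : 0 < alpha x by have /andP[/(le_lt_trans c0)] := halpha x.
have [e e0 He'] := environment_gap [seq pos i | i : I].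
have He i : c + e <= alpha (pos i) by apply/ltW/He'/map_f; rewrite mem_enum.
set D := fun y => c + e <= alpha y.
have surv1 n j : C j -> 1 <= survival p D n (pos j).
  elim: n j => [|n IH] j Cj; rewrite /= /D He// mul1r.
  rewrite -[leLHS](backward_mean_cst hp (pos j) ler01).
  apply: le_backward_mean => //.
  - by exists 1 => y; rewrite ler01 lexx.
  - by exists 1 => y; exact: survival_itv.
  move=> y py; suff [i -> Ci] : exists2 i, y = pos i & C i by exact: IH.
  case vy: (vertex pos y) => [i|].
    have yE := vertex_Some vy; exists i => //.
    have [|_ [<-]//] := HC j Cj (Some i).
    by rewrite /rate mulr_gt0// -yE.
  have [|//] := HC j Cj None.
  rewrite /rate -lte_fin fineK; last first.
    by apply: esum_outside_fin => // x; have /andP[_ ->] := halpha x; rewrite ltW.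
  apply: (@lt_le_trans _ _ (alpha y * p (pos j - y))%:E).
    by rewrite lte_fin mulr_gt0.
  apply: esum_ge; exists [set y]; last by rewrite fsbig_set1.
  by split => // _ ->.
have [n _ /(_ n (leqnn n))] : \forall n \near \oo, survival p D n (pos i0) < 1.
  exact: cvgr_lt (survival0 (pos i0) e0) _ ltr01.
by rewrite /= ltNge surv1.
Qed.

End fugacity_profile.

(** * Truncation of occupation numbers and conclusion *)

Section levels.
Context {R : realType}.
Variable N : nat.

Definition cap_natbar (n : natbar) : 'I_N.+1 :=
  if n is Some k then inord (minn k N) else ord_max.

(** Level [N] is read as infinity, so that capping and reading back can only increase a
    configuration: upper bounds survive the rounding. *)
Definition uncap (k : 'I_N.+1) : natbar := if (k < N)%N then Some (k : nat) else None.

Lemma uncap_cap (n : natbar) : uncap (cap_natbar n) =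
  if n is Some k then if (k < N)%N then Some k else None else None.
Proof.
case: n => [k|]; rewrite /uncap /cap_natbar /= ?ltnn// inordK ?ltnS ?geq_minr//.
by rewrite gtn_min ltnn orbF; case: ltnP => // /ltnW/minn_idPl ->.
Qed.

Lemma le_uncap_cap (n : natbar) : le_natbar n (uncap (cap_natbar n)).
Proof. by rewrite uncap_cap; case: n => //= k; case: ifP => /=. Qed.

Lemma uncap_cap_homo (m n : natbar) : le_natbar m n ->
  le_natbar (uncap (cap_natbar m)) (uncap (cap_natbar n)).
Proof.
rewrite !uncap_cap; case: m n => [m|] [n|] //=; last by case: ifP.
by move=> mn; case: (ltnP n N) => nN; [rewrite (leq_ltn_trans mn nN)|case: ifP].
Qed.

(** A sum over level patterns of products of indicators, each continuous because the level is
    constant from [N] on, infinity included. *)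
Lemma continuous_levels (K : eqType) (J : finType) (q : J -> K)
    (H : {ffun J -> 'I_N.+1} -> R) :
  continuous ((fun sigma => H [ffun j => cap_natbar (sigma (q j))]) :
    prod_topology (fun _ : K => natbar) -> R).
Proof.
set T := prod_topology _.
have cind (x : K) k : continuous (fun sigma : T => (cap_natbar (sigma x) == k)%:R : R).
  move=> sigma.
  have cp : continuous (proj x : T -> natbar) by exact: proj_continuous.
  have ci : continuous ((fun n : natbar => (cap_natbar n == k)%:R) : natbar -> R).
    apply: (natbar_eventually_continuous (N := N)) => n Nn.
    rewrite /cap_natbar; congr (_ == _)%:R; apply/val_inj; rewrite /= inordK.
      exact/minn_idPr.
    by rewrite ltnS geq_minr.
  exact (continuous_comp (cp sigma) (ci _)).
have -> : (fun sigma : T => H [ffun j => cap_natbar (sigma (q j))]) =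
    (fun sigma : T => \sum_(ka : {ffun J -> 'I_N.+1})
       H ka * \prod_j (cap_natbar (sigma (q j)) == ka j)%:R).
  apply/funext => sigma; set ka0 := [ffun j => _].
  rewrite (bigD1 ka0)//= [X in _ * X]big1 => [|j _]; last by rewrite ffunE eqxx.
  rewrite mulr1 big1 ?addr0// => ka kane.
  have [j kj] : exists j, cap_natbar (sigma (q j)) != ka j.
    apply: contrapT => /forallNP nk; move/eqP: kane; apply; apply/ffunP => j.
    by have /negP := nk j; rewrite negbK ffunE => /eqP.
  by rewrite (bigD1 j)//= (negbTE kj) mul0r mulr0.
apply: (continuous_big (@add_continuous R)) => ka _ sigma.
have h1 : continuous (fun _ : T => H ka) by move=> x; apply: cst_continuous.
have h2 : continuous (fun sigma : T =>
    \prod_j ((cap_natbar (sigma (q j)) == ka j)%:R : R)).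
  by apply: (continuous_big (@mul_continuous R)) => j _; exact: cind.
exact (continuousM (h1 sigma) (h2 sigma)).
Qed.

End levels.

(** * Probabilities of levels and their continuity in the fugacity *)

Section level_masses.
Context {R : realType}.
Variable g : nat -> R.
Hypothesis hg : jump_rate g.

Definition level_mass N (l : R) (k : 'I_N.+1) : R :=
  weighted_sum (theta_weight g l) (fun n => (cap_natbar N (Some n) == k)%:R) /
  partition_fun g l.

(** Dominated convergence relative to the largest parameter: [theta_weight g m k] is [(m / l1) ^+ k]
    times [theta_weight g l1 k], and these powers stay in [0, 1] and converge from above. *)
Lemma weighted_theta_cvg (u : nat -> R) (l l1 : R) (F : nat -> R) :
  0 <= l -> (forall n, l <= u n <= l1) -> 0 < l1 < 1 -> u @ \oo --> l ->
  (forall k, 0 <= F k <= 1) ->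
  (fun n => weighted_sum (theta_weight g (u n)) F) @ \oo -->
  weighted_sum (theta_weight g l) F.
Proof.
move=> l0 ul /andP[l10 l11] ucvg F01.
have l1' : 0 <= l1 < 1 by rewrite ltW.
have w0 n : 0 <= theta_weight g l1 n by apply: theta_weight_ge0 => //; exact: ltW.
have wfin : (\esum_(n in [set: nat]) (theta_weight g l1 n)%:E < +oo)%E.
  by rewrite esum_theta_weight// ltry.
have rescale m : weighted_sum (theta_weight g m) F =
    weighted_sum (theta_weight g l1) (fun k => (m / l1) ^+ k * F k).
  congr fine; apply: eq_esum => k _; congr (_%:E); rewrite mulrA; congr (_ * _).
  by rewrite /theta_weight expr_div_n; field; rewrite !gt_eqF ?gfact_gt0 ?exprn_gt0.
pose r := l / l1; pose v n := u n / l1.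
have r01 : 0 <= r by rewrite divr_ge0// ltW.
have rv n : r <= v n by rewrite ler_wpM2r ?invr_ge0 ?(ltW l10)//; have /andP[] := ul n.
have v1 n : v n <= 1 by rewrite ler_pdivrMr// mul1r; have /andP[] := ul n.
have vcvg : v @ \oo --> r by exact: cvgMr_tmp.
have bF m : 0 <= m <= 1 -> nonneg_bounded (fun k => m ^+ k * F k).
  move=> /andP[m0 m1]; exists 1 => k; have /andP[F0 F1] := F01 k.
  by rewrite mulr_ge0 ?exprn_ge0//= mulr_ile1 ?exprn_ge0// exprn_ile1.
have D01 n k : 0 <= (v n ^+ k - r ^+ k) * F k <= 1.
  have /andP[F0 F1] := F01 k.
  have vr : r ^+ k <= v n ^+ k by rewrite lerXn2r// ?nnegrE// (le_trans r01).
  have vk1 : v n ^+ k <= 1 by rewrite exprn_ile1// (le_trans r01).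
  have rk : 0 <= r ^+ k by rewrite exprn_ge0.
  by rewrite mulr_ge0 ?subr_ge0//= mulr_ile1 ?subr_ge0//; lra.
have diff n : weighted_sum (theta_weight g l1) (fun k => v n ^+ k * F k) =
    weighted_sum (theta_weight g l1) (fun k => r ^+ k * F k) +
    weighted_sum (theta_weight g l1) (fun k => (v n ^+ k - r ^+ k) * F k).
  rewrite -weighted_sumD//.
  - by congr weighted_sum; apply/funext => k; ring.
  - by apply: bF; rewrite r01 (le_trans (rv n)).
  - by exists 1.
have -> : (fun n => weighted_sum (theta_weight g (u n)) F) = (fun n =>
    weighted_sum (theta_weight g l1) (fun k => r ^+ k * F k) +
    weighted_sum (theta_weight g l1) (fun k => (v n ^+ k - r ^+ k) * F k)).
  by apply/funext => n; rewrite rescale diff.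
rewrite rescale -[X in _ --> X]addr0; apply: cvgD; first exact: cvg_cst.
apply/cvgrPdist_lt => e e0; have e2 : 0 < e / 2 by rewrite divr_gt0.
have [X [_ tailX]] := weighted_tail w0 wfin e2.
have sumX : (fun n => \sum_(k <- X) theta_weight g l1 k * ((v n ^+ k - r ^+ k) * F k))
    @ \oo --> \sum_(k <- X) theta_weight g l1 k * ((r ^+ k - r ^+ k) * F k).
  apply: (@cvg_big _ _ +%R 0 xpredT (@add_continuous R)) => k _.
  apply: cvgMl_tmp; apply: cvgMr_tmp; apply: cvgB; last exact: cvg_cst.
  exact: (cvg_comp _ _ vcvg (@exprn_continuous _ k r)).
have sumX0 : \sum_(k <- X) theta_weight g l1 k * ((r ^+ k - r ^+ k) * F k) = 0.
  by rewrite big1// => k _; rewrite subrr mul0r mulr0.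
rewrite sumX0 in sumX.
have [n0 _ Hn0] : \forall n \near \oo,
    \sum_(k <- X) theta_weight g l1 k * ((v n ^+ k - r ^+ k) * F k) < e / 2.
  exact: cvgr_lt sumX _ e2.
exists n0 => // n /Hn0 /= Hn; rewrite sub0r normrN ger0_norm; last first.
  by apply: weighted_sum_ge0 => //; exists 1.
by apply: le_lt_trans (tailX _ 1 ler01 (D01 n)) _; rewrite mul1r; lra.
Qed.

Lemma partition_funE l : 0 <= l < 1 ->
  partition_fun g l = weighted_sum (theta_weight g l) (fun=> 1).
Proof.
move=> l01; rewrite /weighted_sum; under eq_esum do rewrite mulr1.
by rewrite esum_theta_weight.
Qed.

Lemma level_mass_cvg N k (u : nat -> R) (l l1 : R) :
  0 <= l -> (forall n, l <= u n <= l1) -> 0 < l1 < 1 -> u @ \oo --> l ->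
  (fun n => level_mass (u n) k) @ \oo --> @level_mass N l k.
Proof.
move=> l0 ul l101 ucvg; have /andP[l10 l11] := l101.
have l01 : 0 <= l < 1.
  by have /andP[h1 h2] := ul 0%N; rewrite l0 (le_lt_trans _ l11)// (le_trans h1).
have u01 n : 0 <= u n < 1.
  by have /andP[h1 h2] := ul n; rewrite (le_trans l0)//= (le_lt_trans _ l11).
apply: cvgM.
  by apply: (weighted_theta_cvg l0 ul l101 ucvg) => n; case: eqP; rewrite ?ler01 ?lexx.
apply: cvgV; first by rewrite gt_eqF// partition_fun_gt0.
rewrite partition_funE// (_ : (fun n => partition_fun g (u n)) =
  (fun n => weighted_sum (theta_weight g (u n)) (fun=> 1))); last first.
  by apply/funext => n; rewrite partition_funE.
by apply: (weighted_theta_cvg l0 ul l101 ucvg) => n; rewrite ler01 lexx.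
Qed.

End level_masses.

Section level_expansions.
Context {R : realType}.
Variable g : nat -> R.
Hypothesis hg : jump_rate g.
Variable N : nat.

Lemma sum_levels (J : finType) (H : {ffun J -> 'I_N.+1} -> R) ka0 :
  H ka0 = \sum_ka H ka * (ka == ka0)%:R.
Proof.
rewrite (bigD1 ka0)//= eqxx mulr1 big1 ?addr0// => ka /negbTE ->.
by rewrite mulr0.
Qed.

(** Showing the pattern [ka] is a product event: [A i] imposes a level if [i] is in the range of [q]
    and nothing otherwise. The free vertices contribute their partition functions. *)
Lemma equilibrium_levels (I J : finType) (q : J -> I) (phi : I -> R)
    (H : {ffun J -> 'I_N.+1} -> R) : injective q -> (forall i, 0 < phi i < 1) ->
  (forall ka, 0 <= H ka) ->
  equilibrium g phi (fun sigma => H [ffun j => cap_natbar N (sigma (q j))]) =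
  (\prod_i partition_fun g (phi i)) *
  \sum_ka H ka * \prod_j level_mass g (phi (q j)) (ka j).
Proof.
move=> q_inj phi01 H0.
have phi_itv i : 0 <= phi i < 1 by have /andP[/ltW-> ->] := phi01 i.
have phi0 i : 0 <= phi i by have /andP[] := phi_itv i.
have w0 (xi : {ffun I -> nat}) : 0 <= weight g phi xi by exact/ltW/weight_gt0.
have wfin : (\esum_(xi in [set: {ffun I -> nat}]) (weight g phi xi)%:E < +oo)%E.
  by rewrite esum_weight// ltry.
pose lev (xi : {ffun I -> nat}) : {ffun J -> 'I_N.+1} :=
  [ffun j => cap_natbar N (Some (xi (q j)))].
have bind ka : nonneg_bounded (fun xi => (ka == lev xi)%:R : R).
  by exists 1 => xi; case: eqP; rewrite ?ler01 ?lexx.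
have -> : equilibrium g phi (fun sigma => H [ffun j => cap_natbar N (sigma (q j))]) =
    weighted_sum (weight g phi) (fun xi => \sum_ka H ka * (ka == lev xi)%:R).
  by congr weighted_sum; apply/funext => xi /=; rewrite -sum_levels.
rewrite weighted_sum_sum//; last by move=> ka; exact: nonneg_boundedZ.
rewrite mulr_sumr; apply: eq_bigr => ka _.
rewrite weighted_sumZ// [RHS]mulrCA; congr (_ * _).
pose A i : set nat := [set n | forall j, q j = i -> cap_natbar N (Some n) = ka j].
pose V i : R := partition_fun g (phi i) * \prod_(j | q j == i) level_mass g (phi i) (ka j).
have VE i : (\esum_(n in A i) (theta_weight g (phi i) n)%:E = (V i)%:E)%E.
  have Z0 := partition_fun_gt0 hg (phi_itv i).
  have [[j ji]|noj] := pselect (exists j, q j = i).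
    rewrite /V (big_pred1 j) => [|j']; last first.
      by rewrite -ji /=; apply/eqP/eqP => [/q_inj|->].
    rewrite /level_mass mulrC divfK ?gt_eqF// weighted_sumE; last 3 first.
    - by move=> n; exact: theta_weight_ge0.
    - by rewrite esum_theta_weight// ltry.
    - by exists 1 => n; case: eqP; rewrite ?ler01 ?lexx.
    rewrite esum_mkcond; apply: eq_esum => n _.
    case: ifPn => [/set_mem/(_ j ji) ->|/negP nA]; first by rewrite eqxx mulr1.
    case: eqP => [e|_]; last by rewrite mulr0.
    by exfalso; apply: nA; apply/mem_set => j'; rewrite -ji => /q_inj ->.
  rewrite /V big_pred0 => [|j]; last by apply/eqP => ji; apply: noj; exists j.
  rewrite mulr1 -esum_theta_weight//; congr esum.
  by apply/seteqP; split => n //= _ j ji; exfalso; apply: noj; exists j.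
have -> : \prod_i partition_fun g (phi i) * \prod_j level_mass g (phi (q j)) (ka j) =
    \prod_i V i.
  rewrite /V [RHS]big_split/=; congr (_ * _).
  rewrite (partition_big q xpredT)//=; apply: eq_bigr => i _.
  by apply: eq_bigr => j /eqP ->.
apply: EFin_inj; rewrite -(esum_prod (A := A) (v := fun i n => theta_weight g (phi i) n)).
- rewrite weighted_sumE// [RHS]esum_mkcond; apply: eq_esum => xi _.
  case: ifPn => [/set_mem/= HA|/negP nA].
    rewrite (_ : ka == lev xi) ?mulr1//; apply/eqP/ffunP => j.
    by rewrite ffunE (HA (q j) j erefl).
  case: eqP => [kaE|_]; last by rewrite mulr0.
  exfalso; apply: nA; apply/mem_set => i j ji.
  by rewrite kaE ffunE ji.
- by move=> i n; exact: theta_weight_ge0.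
- exact: VE.
Qed.

Section product_measure.
Context {d : nat} (alpha : site d -> R) (c : R).
Hypothesis c0 : 0 < c.
Hypothesis halpha : environment c alpha.
Variable mu : probability (config d) R.
Hypothesis hmu : is_mu g alpha c mu.
Variable s : seq (site d).
Hypothesis us : uniq s.

Local Notation J := (seq_sub s).

Lemma prod_seq_sub (F : site d -> R) : \prod_(x <- s) F x = \prod_(j : J) F (val j).
Proof.
rewrite -(big_map val predT F); apply: perm_big; apply: uniq_perm => //.
  by rewrite map_inj_uniq ?index_enum_uniq//; exact: val_inj.
move=> x; apply/idP/mapP => [xs|[j _ ->]]; last exact: ssvalP.
by exists (SeqSub xs) => //; rewrite mem_index_enum.
Qed.

Let ratio x : 0 <= c / alpha x < 1.
Proof.
have /andP[cx _] := halpha x; have ax := lt_trans c0 cx.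
by rewrite divr_ge0 ?ltW//= ltr_pdivrMr// mul1r.
Qed.

Lemma mu_levels (ka : {ffun J -> 'I_N.+1}) :
  mu [set eta : config d | ka = [ffun j => cap_natbar N (eta (val j))]] =
  (\prod_j level_mass g (c / alpha (val j)) (ka j))%:E.
Proof.
pose A (x : site d) : set natbar :=
  [set n | forall j : J, val j = x -> cap_natbar N n = ka j].
have -> : [set eta : config d | ka = [ffun j => cap_natbar N (eta (val j))]] =
    [set eta : config d | forall x : site d, x \in s -> A x (eta x)].
  apply/seteqP; split => eta /= H.
    by move=> x xs j jx; rewrite H ffunE jx.
  by apply/ffunP => j; rewrite ffunE; apply/esym/(H (val j) (ssvalP j)).
rewrite (hmu A us).
pose m x := fine (theta_measure g (c / alpha x) (A x)).
have mE j : theta_measure g (c / alpha (val j)) (A (val j)) =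
    (level_mass g (c / alpha (val j)) (ka j))%:E.
  have l01 := ratio (val j); have /andP[l0 _] := l01.
  have Z0 := partition_fun_gt0 hg l01.
  move: (c / alpha (val j)) l01 l0 Z0 => l l01 l0 Z0.
  rewrite /theta_measure /level_mass [_ / partition_fun g l]mulrC EFinM.
  rewrite weighted_sumE; last 3 first.
  - by move=> n; exact: theta_weight_ge0.
  - by rewrite esum_theta_weight// ltry.
  - by exists 1 => n; case: eqP; rewrite ?ler01 ?lexx.
  rewrite -esumZl ?invr_ge0 ?ltW//; last first.
    by move=> n; rewrite mulr_ge0// theta_weight_ge0.
  rewrite esum_mkcond; apply: eq_esum => n _; rewrite /theta.
  case: ifPn => [/set_mem/(_ j erefl) ->|/negP nA].
    by rewrite eqxx mulr1.
  case: eqP => [e|_]; last by rewrite !mulr0.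
  by exfalso; apply: nA; apply/mem_set => j' /val_inj ->.
have -> : (\prod_(x <- s) theta_measure g (c / alpha x) (A x) =
    \prod_(x <- s) (m x)%:E)%E.
  apply: eq_big_seq => x xs; rewrite /m fineK//.
  by rewrite (mE (SeqSub xs)).
rewrite prodEFin prod_seq_sub; congr (_%:E); apply: eq_bigr => j _.
by rewrite /m mE.
Qed.

Lemma measurable_levels (ka : {ffun J -> 'I_N.+1}) :
  measurable [set eta : config d | ka = [ffun j => cap_natbar N (eta (val j))]].
Proof.
have := continuous_config_measurable (@continuous_levels R N _ J val
  (fun ka' => (ka == ka')%:R)).
move=> /(_ measurableT [set 1] (measurable_set1 1)); rewrite setTI.
congr measurable; apply/seteqP; split => eta /=.
  by case: eqP => // _ /esym/eqP; rewrite oner_eq0.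
by move=> <-; rewrite eqxx.
Qed.

Lemma integral_levels (H : {ffun J -> 'I_N.+1} -> R) : (forall ka, 0 <= H ka) ->
  \int[mu]_eta H [ffun j => cap_natbar N (eta (val j))] =
  \sum_ka H ka * \prod_j level_mass g (c / alpha (val j)) (ka j).
Proof.
move=> H0; apply: EFin_inj.
pose B (ka : {ffun J -> 'I_N.+1}) :=
  [set eta : config d | ka = [ffun j => cap_natbar N (eta (val j))]].
have intE : (\int[mu]_eta (H [ffun j => cap_natbar N (eta (val j))])%:E =
    \sum_ka (H ka)%:E * mu (B ka))%E.
  under eq_integral => eta _.
    rewrite (sum_levels H) -sumEFin.
    under eq_bigr => ka _.
      rewrite EFinM (_ : (ka == _)%:R = \1_(B ka) eta); last first.
        rewrite indicE; congr (nat_of_bool _)%:R; apply/idP/idP => [/eqP e|/set_mem/= <-//].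
        exact/mem_set.
      over.
    over.
  rewrite ge0_integral_sum//.
  - apply: eq_bigr => ka _; rewrite ge0_integralZl//.
    + by rewrite integral_indic ?setIT//; exact: measurable_levels.
    + apply/measurable_EFinP; apply: measurable_indic; exact: measurable_levels.
    + by rewrite lee_fin ?H0.
  - move=> ka; apply: measurable_funeM; apply/measurable_EFinP.
    apply: measurable_indic; exact: measurable_levels.
  - by move=> ka eta _; rewrite mule_ge0// lee_fin ?H0.
rewrite /Rintegral intE -sumEFin fineK.
  by apply: eq_bigr => ka _; rewrite mu_levels -EFinM.
by rewrite sum_fin_num; apply/allP => x /mapP[ka _ ->]; rewrite mu_levels.
Qed.

End product_measure.

End level_expansions.

(** * Upper bounds for the semigroup at large times *)

Section upper_bound.
Context {R : realType} {d : nat}.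
Variable c : R.
Hypothesis c01 : 0 < c < 1.
Variable g : nat -> R.
Hypothesis hg : jump_rate g.
Variable p : site d -> R.
Hypothesis hp : jump_law p.
Variable alpha : site d -> R.
Hypothesis halpha : environment c alpha.
Hypothesis survival0 : forall (e : R) x, 0 < e ->
  (fun n => survival p (fun y => c + e <= alpha y) n x) @ \oo --> 0.
Variable mu : probability (config d) R.
Hypothesis hmu : is_mu g alpha c mu.
Variable S : R -> R.-pker (config d) ~> (config d).
Hypothesis hS : feller_semigroup S.
Hypothesis hgen : forall f : config d -> R, continuous f -> local_fun f ->
  in_generator S f (zr_generator g p alpha f).
Variable eta0 : site d -> nat.

Let start : config d := fun x => Some (eta0 x).
Let c0 : 0 < c. Proof. by have /andP[] := c01. Qed.
Let alpha_gt0 x : 0 < alpha x.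
Proof. by have /andP[/(lt_trans c0)] := halpha x. Qed.
Let alpha_itv x : 0 <= alpha x <= 1.
Proof. by rewrite ltW//=; have /andP[] := halpha x. Qed.

Section levels.
Variables (s : seq (site d)) (N : nat) (M : R).
Variable H : {ffun seq_sub s -> 'I_N.+1} -> R.
Hypothesis HM : forall ka, 0 <= H ka <= M.
Hypothesis Hmono : forall ka ka' : {ffun seq_sub s -> 'I_N.+1},
  (forall j, le_natbar (uncap (ka j)) (uncap (ka' j))) ->
  H ka <= H ka'.

Local Notation hN := (fun eta : config d => H [ffun j => cap_natbar N (eta (val j))]).

Let H0 ka : 0 <= H ka. Proof. by have /andP[] := HM ka. Qed.

Lemma transition_levels (lam : site d -> R) (L : seq (site d)) :
  (forall x, c <= lam x <= alpha x) ->
  (forall x, lam x < alpha x -> x \in L) ->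
  (forall x, lam x < alpha x -> backward_mean p lam x <= lam x) ->
  (forall x, x \in s -> lam x < alpha x) ->
  forall e : R, 0 < e -> \forall t \near +oo, transition_op S t hN start <=
    \sum_ka H ka * \prod_j level_mass g (lam (val j) / alpha (val j)) (ka j) + e.
Proof.
move=> lam_itv lamL lamsup lams e e0.
(* Keeping exactly the sites with [lam x < alpha x] gives [phi < 1] at the vertices and
   [lam = alpha] at every site merged into the reservoir. *)
pose L' := undup [seq x <- L | lam x < alpha x].
have L'E x : (x \in L') = (lam x < alpha x).
  rewrite mem_undup mem_filter andb_idr//; exact: lamL.
pose I : finType := seq_sub L'.
pose pos : I -> site d := val.
have pos_inj : injective pos by exact: val_inj.
have pos_lt i : lam (pos i) < alpha (pos i) by rewrite -L'E; exact: ssvalP.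
have lam0 x : 0 < lam x by have /andP[/(lt_le_trans c0)] := lam_itv x.
pose phi i := lam (pos i) / alpha (pos i).
have phi01 i : 0 < phi i < 1 by rewrite divr_gt0//= ltr_pdivrMr// mul1r.
have outE x : outside pos x -> lam x = alpha x.
  move=> xO; apply/eqP; rewrite eq_le; have /andP[_ ->] := lam_itv x.
  rewrite leNgt -L'E; apply/negP => xL.
  by move: xO; rewrite /outside/= (_ : x = pos (SeqSub xL))// vertex_pos.
pose Q := rate pos p alpha.
have Q0 e' : 0 <= Q e' by exact: rate_ge0.
have blam : nonneg_bounded lam.
  by exists 1 => x; rewrite ltW//=; have /andP[_ /le_trans] := lam_itv x; apply;
    have /andP[] := alpha_itv x.
(* A vertex feeds [j] with its [lam] times [p], and so does the reservoir, where [lam = alpha]: the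
   inflow is the backward mean of [lam]. *)
have sup j : \sum_a fugacity phi a * Q (a, Some j) <= phi j * \sum_b Q (Some j, b).
  rewrite sum_rate_from /phi divfK ?gt_eqF//.
  apply: le_trans (lamsup _ (pos_lt j)); rewrite sum_option/= mul1r.
  rewrite -lee_fin /backward_mean weighted_sumE//; last 2 first.
  - by move=> y; have [] := hp.
  - exact: backward_weight_fin.
  rewrite (esum_vertex pos_inj); last first.
    by move=> x; rewrite mulr_ge0//; [have [] := hp|exact: ltW].
  rewrite addrC EFinD; apply: leeD.
    rewrite lee_fin; apply: ler_sum => i _.
    by rewrite /phi mulrA divfK ?gt_eqF// mulrC.
  rewrite fineK; last by apply: esum_outside_fin.
  by apply: le_esum => x xO; rewrite lee_fin mulrC (outE x xO).
have conn := rate_connected hp c01 halpha survival0 pos_inj.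
have qP (j : seq_sub s) : exists i, pos i = val j.
  have jL : val j \in L' by rewrite L'E; apply: lams; exact: ssvalP.
  by exists (SeqSub jL).
have [q Hq] := choice qP.
have q_inj : injective q by move=> i j qij; apply: val_inj; rewrite -!Hq qij.
pose f (sigma : I -> natbar) := H [ffun j => cap_natbar N (sigma (q j))].
have fM sigma : 0 <= f sigma <= M by exact: HM.
have fmono : nondecreasing_state f.
  move=> eta zeta le_ez; apply: Hmono => j; rewrite !ffunE.
  exact: uncap_cap_homo.
have cf : continuous (f : prod_topology (fun _ : I => natbar) -> R).
  exact: continuous_levels.
have fE : f \o restrict pos = hN.
  apply/funext => eta /=; congr H; apply/ffunP => j.
  by rewrite !ffunE /restrict Hq.
pose xi0 : {ffun I -> nat} := [ffun i => eta0 (pos i)].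
have startE : restrict pos start = state xi0.
  by apply/funext => i; rewrite /restrict /state ffunE.
pose Z := \prod_i partition_fun g (phi i).
have Z0 : 0 < Z.
  apply: prodr_gt0 => i _; apply: partition_fun_gt0 => //.
  by have /andP[/ltW-> ->] := phi01 i.
have e2 : 0 < e / 2 by rewrite divr_gt0.
have eZ : 0 < e / 2 * Z by rewrite mulr_gt0.
have [n0 Hn0] := evolution_limsup hg Q0 phi01 sup fmono fM conn xi0 eZ.
pose V := \sum_ka H ka * \prod_j level_mass g (lam (val j) / alpha (val j)) (ka j).
have eqE : equilibrium g phi f = Z * V.
  rewrite (equilibrium_levels hg q_inj phi01 H0); congr (_ * _).
  by apply: eq_bigr => ka _; congr (_ * _); apply: eq_bigr => j _; rewrite /phi Hq.
have V0 : 0 <= V.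
  have := weighted_sum_ge0 (w := weight g phi); rewrite -(pmulr_rge0 _ Z0) -eqE.
  apply; last by exists M => xi; exact: fM.
  - by move=> xi; exact/ltW/weight_gt0.
  - by rewrite esum_weight// ltry.
have l0 : 0 <= V + e / 2 by rewrite addr_ge0// ltW.
have evo n : (n0 <= n)%N -> evolution g Q f n (restrict pos start) <= V + e / 2.
  by move=> /Hn0; rewrite -/Z eqE [Z * V]mulrC -mulrDl -startE ler_pM2r.
have := transition_op_limsup pos_inj hp alpha_itv hg hS hgen cf fmono fM l0 evo e2.
by rewrite fE -addrA -splitr.
Qed.

End levels.

Lemma levels_limsup (s : seq (site d)) (N : nat) (M : R)
    (H : {ffun seq_sub s -> 'I_N.+1} -> R) : uniq s ->
  (forall ka, 0 <= H ka <= M) ->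
  (forall ka ka' : {ffun seq_sub s -> 'I_N.+1},
    (forall j, le_natbar (uncap (ka j)) (uncap (ka' j))) -> H ka <= H ka') ->
  forall e : R, 0 < e -> \forall t \near +oo,
    transition_op S t (fun eta => H [ffun j => cap_natbar N (eta (val j))]) start <=
    \int[mu]_eta H [ffun j => cap_natbar N (eta (val j))] + e.
Proof.
move=> us HM Hmono e e0.
have H0 ka : 0 <= H ka by have /andP[] := HM ka.
(* With [lam n <= c + gap < alpha] on [s], the sites of [s] are vertices of every network, and the
   ratios stay below [(c + gap) / alpha < 1] uniformly in [n], as the limit requires. *)
have [gap gap0 Hgap] := environment_gap halpha s.
have gapn n : 0 < gap / n.+1%:R by rewrite divr_gt0.
have [lam Hlam] := choice (fun n =>
  exists_superharmonic hp c01 halpha survival0 s (gapn n)).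
have lamE n : exists L : seq (site d),
  [/\ forall x, c <= lam n x <= alpha x,
      forall x, lam n x < alpha x -> x \in L,
      forall x, lam n x < alpha x -> backward_mean p (lam n) x <= lam n x &
      forall x, x \in s -> lam n x <= c + gap / n.+1%:R] := Hlam n.
have lams n x : x \in s -> lam n x <= c + gap.
  move=> xs; have [L [_ _ _ /(_ x xs)]] := lamE n; move/le_trans; apply.
  rewrite lerD2l; apply: ler_piMr; first exact: ltW.
  by rewrite invf_le1 ?ltr0n ?ler1n.
have lamcvg x : x \in s -> (fun n => lam n x) @ \oo --> c.
  move=> xs; apply: (@squeeze_cvgr _ _ _ _ (fun=> c) (fun n => c + gap / n.+1%:R)).
  - apply: nearW => n; have [L [/(_ x)/andP[-> _] _ _ /(_ x xs) ->]] := lamE n.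
    by [].
  - exact: cvg_cst.
  - rewrite -[X in _ --> X]addr0; apply: cvgD; first exact: cvg_cst.
    rewrite -(mulr0 gap); apply: cvgMl_tmp; exact: cvg_harmonic.
pose V n := \sum_ka H ka * \prod_j level_mass g (lam n (val j) / alpha (val j)) (ka j).
have Vcvg : V @ \oo --> \int[mu]_eta H [ffun j => cap_natbar N (eta (val j))].
  rewrite (integral_levels hg c0 halpha hmu us H0).
  apply: (@cvg_big _ _ +%R 0 xpredT (@add_continuous R)) => ka _.
  apply: cvgMl_tmp.
  apply: (@cvg_big R _ *%R 1 xpredT (@mul_continuous R) nat \oo _
    (fun j n => level_mass g (lam n (val j) / alpha (val j)) (ka j))
    (fun j => level_mass g (c / alpha (val j)) (ka j))) => j _.
  have js : val j \in s by exact: ssvalP.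
  apply: (level_mass_cvg hg _ (l1 := (c + gap) / alpha (val j))).
  - by rewrite divr_ge0// ltW.
  - move=> n; have [L [/(_ (val j))/andP[cl _] _ _ _]] := lamE n.
    have ai : 0 <= (alpha (val j))^-1 by rewrite invr_ge0 ltW.
    by rewrite !ler_wpM2r ?lams.
  - by rewrite divr_gt0 ?addr_gt0//= ltr_pdivrMr// mul1r Hgap.
  - by apply: cvgMr_tmp; exact: lamcvg.
have e2 : 0 < e / 2 by rewrite divr_gt0.
have [n _ /(_ n (leqnn n)) /= Vn] : \forall n \near \oo,
    V n < \int[mu]_eta H [ffun j => cap_natbar N (eta (val j))] + e / 2.
  by apply: cvgr_lt Vcvg _ _; rewrite ltrDl.
have [L [lam_itv lamL lamsup _]] := lamE n.
have lamlt x : x \in s -> lam n x < alpha x.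
  by move=> xs; apply: le_lt_trans (lams n x xs) (Hgap x xs).
have := transition_levels HM Hmono lam_itv lamL lamsup lamlt e2.
apply: filterS => t /le_trans; apply.
by move: Vn; rewrite /V; lra.
Qed.

(** [h] may be discontinuous. The rounded functions [hN N] are continuous, lie above [h] and, at
    each configuration, equal [h] for large [N]; this gives measurability of [h] and, by domination,
    convergence of the integrals. *)
Lemma transition_limsup (h : config d -> R) M : (forall eta, 0 <= h eta <= M) ->
  local_fun h -> nondecreasing_config h ->
  measurable_fun setT h /\
  forall e : R, 0 < e -> \forall t \near +oo,
    transition_op S t h start <= \int[mu]_eta h eta + e.
Proof.
move=> hM [s0 hs0] hmono.
pose s := undup s0; have us : uniq s by exact: undup_uniq.
have hs eta zeta : (forall x, x \in s -> eta x = zeta x) -> h eta = h zeta.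
  by move=> ez; apply: hs0 => x xs; apply: ez; rewrite mem_undup.
pose H N (ka : {ffun seq_sub s -> 'I_N.+1}) : R :=
  h (fun x => if insub x is Some j then uncap (ka j) else None).
pose hN N (eta : config d) := H N [ffun j => cap_natbar N (eta (val j))].
have HM N ka : 0 <= H N ka <= M by exact: hM.
have Hmono N (ka ka' : {ffun seq_sub s -> 'I_N.+1}) :
    (forall j, le_natbar (uncap (ka j)) (uncap (ka' j))) -> H N ka <= H N ka'.
  by move=> le_k; apply: hmono => x; case: insubP => [j _ _|_]; [exact: le_k|].
have hlehN N eta : h eta <= hN N eta.
  apply: hmono => x; case: insubP => [j _ <-|_]; last by case: (eta x).
  by rewrite ffunE; exact: le_uncap_cap.
have hN_cvg eta : (fun N => hN N eta) @ \oo --> h eta.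
  apply: cvg_near_cst.
  (* [n.+1] makes [N] exceed every finite occupation number on [s]; infinite ones are reproduced
     exactly by every [N]. *)
  pose b := \max_(x <- s) (if eta x is Some n then n.+1 else 0%N).
  exists b => // N /= bN; apply: hs => x xs.
  case: insubP => [j _ jx|]; last by rewrite xs.
  rewrite ffunE jx uncap_cap.
  have : ((if eta x is Some n then n.+1 else 0) <= N)%N.
    by apply: leq_trans bN; rewrite /b; apply: leq_bigmax_seq.
  by case: (eta x) => // n ->.
have mhN N : measurable_fun setT (hN N).
  apply: continuous_config_measurable; exact: continuous_levels.
have mh : measurable_fun setT h by apply: (measurable_fun_cvg mhN) => eta _; exact: hN_cvg.
split=> // e e0; have e2 : 0 < e / 2 by rewrite divr_gt0.
have normM (F : config d -> R) : (forall eta, 0 <= F eta <= M) ->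
    forall eta, `|F eta| <= M.
  by move=> FM eta; have /andP[F0 F1] := FM eta; rewrite ger0_norm.
have hNM N eta : 0 <= hN N eta <= M by exact: HM.
have mu1 : mu setT = 1%E by exact: probability_setT.
have ih := bounded_measurable_integrable mu1 mh (normM _ hM).
have ihN N := bounded_measurable_integrable mu1 (mhN N) (normM _ (hNM N)).
have intcvg : (fun N => \int[mu]_eta hN N eta) @ \oo --> \int[mu]_eta h eta.
  apply: fine_cvg; rewrite fineK; last exact: integrable_fin_num.
  apply: (@dominated_cvg _ _ _ _ _ _ _ _ (fun=> M%:E)) => //.
  - by move=> N; apply/measurable_EFinP.
  - by move=> eta _; apply: cvg_EFin; [exact: nearW|exact: hN_cvg].
  - by apply: (bounded_measurable_integrable (F := fun=> M) (M := `|M|)).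
  - by move=> N eta _; rewrite lee_fin normM.
have [N _ /(_ N (leqnn N)) /= HN] : \forall N \near \oo,
    \int[mu]_eta hN N eta < \int[mu]_eta h eta + e / 2.
  by apply: cvgr_lt intcvg _ _; rewrite ltrDl.
have := levels_limsup us (HM N) (Hmono N) e2.
apply: filterS => t ht.
apply: (@le_trans _ _ (transition_op S t (hN N) start)).
  have S1 : S t start setT = 1%E by exact: prob_kernel.
  apply: le_Rintegral => //.
  - exact: bounded_measurable_integrable S1 mh (normM _ hM).
  - exact: bounded_measurable_integrable S1 (mhN N) (normM _ (hNM N)).
by apply: (le_trans ht); move: HN; rewrite /hN; lra.
Qed.

End upper_bound.

(** * The law of the process at a fixed time *)

Section process_law.
Context {R : realType} {d : nat}.
Variable S : R -> R.-pker (config d) ~> (config d).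
Context {dO : measure_display} {Omega : measurableType dO} {P : probability Omega R}.
Variable eta : R -> {RV P >-> config d}.
Hypothesis heta : markov_process S eta.
Variable start : config d.
Hypothesis hstart : {ae P, forall w : Omega, eta 0 w = start}.

Lemma process_law t (B : set (config d)) : 0 <= t -> measurable B ->
  P (eta t @^-1` B) = S t start B.
Proof.
move=> t0 mB.
(* The law at time [t] is the Markov property from time 0 with the sure event. *)
have filT : natural_filtration eta 0 setT.
  by rewrite -setC0; apply: sigma_algebraC; exact: sigma_algebra0.
have := heta (lexx 0) t0 filT mB; rewrite setTI subr0 => ->.
rewrite (@ae_eq_integral _ _ _ _ _ (fun=> S t start B)).
- by rewrite integral_cst//= probability_setT mule1.
- by [].
- apply: (measurableT_comp (f := fun z => S t z B)); first exact: measurable_kernel.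
  exact: measurable_funP.
- exact: measurable_cst.
- by apply: filterS hstart => w -> _.
Qed.

Lemma expectation_process t (F : config d -> R) M : 0 <= t ->
  measurable_fun setT F -> (forall zeta, `|F zeta| <= M) ->
  \int[P]_w F (eta t w) = transition_op S t F start.
Proof.
move=> t0 mF FM; rewrite /transition_op /Rintegral; congr fine.
have meta : measurable_fun setT (eta t) by exact: measurable_funP.
rewrite -(@eq_measure_integral _ _ _ _ _ (pushforward P (eta t))).
  rewrite integral_pushforward//.
  - exact/measurable_EFinP.
  - apply: (bounded_measurable_integrable (F := F \o eta t) (M := M)).
    + exact: probability_setT.
    + exact: measurableT_comp.
    + by move=> w; exact: FM.
by move=> B mB _; exact: process_law.
Qed.

End process_law.

Lemma limn_einf_ge (R : realType) (u : (\bar R)^nat) (b : \bar R) :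
  (forall n, (b <= u n)%E) -> (b <= limn_einf u)%E.
Proof.
move=> bu; rewrite limn_einf_lim; apply: lime_ge; first exact: is_cvg_einfs.
by apply: nearW => n; apply: le_ereal_inf_tmp => _ [m /= _ <-].
Qed.

Unset Implicit Arguments.
Set Strict Implicit.
Set Printing Implicit Defensive.

Theorem theorem2p1 (R : realType) (d : nat) (hd : (1 <= d)%N)
    (c : R) (hc : 0 < c < 1)
    (g : nat -> R) (hg : jump_rate g)
    (p : site d -> R) (hp : jump_law p)
    (alpha : site d -> R) (halpha : environment c alpha)
    (dW : measure_display) (W : measurableType dW) (Q : probability W R)
    (X : site d -> nat -> W -> site d)
    (hX : forall x, random_walk (fun z => p (- z)) x Q (X x))
    (hliminf : forall x,
      {ae Q, forall w, limn_einf (fun n => (alpha (X x n w))%:E) = c%:E})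
    (mu : probability (config d) R) (hmu : is_mu g alpha c mu)
    (eta0 : site d -> nat)
    (dO : measure_display) (Omega : measurableType dO)
    (P : probability Omega R) (eta : R -> {RV P >-> config d})
    (heta : zero_range_process g p alpha eta (fun x => Some (eta0 x)))
    (h : config d -> R) (hbounded : bounded_fun h) (hlocal : local_fun h)
    (hmono : nondecreasing_config h) :
  (limf_esup (fun t : R => 'E_P[h \o eta t]) (pinfty_nbhs R)
     <= \int[mu]_zeta (h zeta)%:E)%E.
Proof.
have [S [hS hgen hmarkov hstart]] := heta.
have survival0 (e : R) x : 0 < e ->
    (fun n => survival p (fun y => c + e <= alpha y) n x) @ \oo --> 0.
  move=> e0; apply: (survival_cvg0 hp (hX x)).
  (* A trajectory staying forever where [alpha] is at least [c + e] would have its liminf at least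
     [c + e]. *)
  apply: filterS (hliminf x) => w liminf_c; apply: contrapT => /forallNP inD.
  have : ((c + e)%:E <= limn_einf (fun n => (alpha (X x n w))%:E))%E.
    by apply: limn_einf_ge => n; rewrite lee_fin; have /negP := inD n; rewrite negbK.
  by rewrite liminf_c lee_fin; lra.
have [M hM] : exists M, forall eta, `|h eta| <= M.
  by have [M [_ HM]] := hbounded; exists (M + 1) => zeta; apply: HM => //; rewrite ltrDl.
(* The shift makes the function nonnegative and adds [M] to both sides. *)
pose h' zeta := h zeta + M.
have h'M zeta : 0 <= h' zeta <= M + M.
  by have := hM zeta; rewrite ler_norml /h' => /andP[? ?]; lra.
have h'local : local_fun h'.
  by have [s hs] := hlocal; exists s => z1 z2 /hs; rewrite /h' => ->.
have h'mono : nondecreasing_config h'.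
  by move=> z1 z2 /hmono; rewrite /h' lerD2r.
have [mh' h'limsup] := transition_limsup hc hg hp halpha survival0 hmu hS hgen eta0
  h'M h'local h'mono.
have mh : measurable_fun setT h.
  have -> : h = (fun zeta => h' zeta - M) by apply/funext => zeta; rewrite /h' addrK.
  by apply: measurable_funB => //; exact: measurable_cst.
have Rint_shift (dT : measure_display) (T : measurableType dT) (m : probability T R)
    (f : T -> R) : measurable_fun setT f -> (forall x, `|f x| <= M) ->
    m.-integrable setT (EFin \o f) /\
    \int[m]_x (f x + M) = \int[m]_x f x + M.
  move=> mf fM; have m1 : m setT = 1%E by exact: probability_setT.
  have intf := bounded_measurable_integrable m1 mf fM.
  split => //; rewrite RintegralD//; last first.
    by apply: (bounded_measurable_integrable (F := fun=> M) (M := `|M|)).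
  by rewrite Rintegral_cst//= m1/= mulr1.
have [imuh muh] := Rint_shift _ _ mu h mh hM.
apply/lee_addgt0Pr => e e0.
have -> : (\int[mu]_zeta (h zeta)%:E = (\int[mu]_zeta h zeta)%:E)%E.
  by rewrite /Rintegral fineK//; exact: integrable_fin_num.
rewrite limf_esupE -EFinD.
pose E t := expectation P (h \o eta t).
(* The limsup is an infimum over neighbourhoods of infinity of suprema; [V] is the neighbourhood
   used. *)
pose V := [set t : R | (E t <= (\int[mu]_zeta h zeta + e)%:E)%E].
apply: (@le_trans _ _ (ereal_sup (E @` V))); last first.
  by apply: ge_ereal_sup => _ [t /= Vt <-].
apply: ereal_inf_lbound; exists V => //.
near=> t.
have t0 : 0 <= t by near: t; exact: nbhs_pinfty_ge.
have ht : transition_op S t h' (fun x => Some (eta0 x)) <= \int[mu]_zeta h' zeta + e.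
  by near: t; exact: h'limsup.
have meta : measurable_fun setT (eta t) by exact: measurable_funP.
have [ih Ph] := Rint_shift _ _ P (h \o eta t) (measurableT_comp mh meta) (fun w => hM _).
rewrite /V/= /E expectation.unlock.
have -> : (\int[P]_w ((h \o eta t) w)%:E = (\int[P]_w (h \o eta t) w)%:E)%E.
  by rewrite /Rintegral fineK//; exact: integrable_fin_num.
rewrite lee_fin -(lerD2r M) -Ph.
have -> : \int[P]_w ((h \o eta t) w + M) = transition_op S t h' (fun x => Some (eta0 x)).
  apply: (expectation_process hmarkov hstart (F := h') (M := M + M)) => // zeta.
  by have /andP[h0 h1] := h'M zeta; rewrite ger0_norm.
by rewrite addrAC -muh.
Unshelve. all: by end_near. Qed.
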